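(* Let $\nu$ be a computable probability measure on Cantor space $2^{\mathbb{N}}$ with full support. Then $\mathsf{MLR}^{\nu}\subseteq \mathsf{MR}^{\nu}_2(\ll_{comp}, \mathscr{F}_{n+1},H)$.
   Context: A probability measure $\nu$ on Cantor space is identified with the function $\sigma\mapsto\nu(\sigma):=\nu([\sigma])$ on $2^{<\mathbb{N}}$, where $[\sigma]$ is the set of $\omega\in 2^{\mathbb{N}}$ extending $\sigma$. It is computable if the reals $\nu(\sigma)$ are computable uniformly in $\sigma$; it has full support if $\nu(\sigma)>0$ for all $\sigma$. $\omega\upharpoonright n$ is the length-$n$ initial segment of $\omega$. $\mathscr{F}_n$ is the $\sigma$-algebra generated by the sets $[\sigma]$ with $|\sigma|=n$. Hellinger distance: for probability measures $P\ll Q$ on a $\sigma$-algebra, $H(P,Q)=\big(2(1-\mathbb{E}_Q[(\frac{dP}{dQ})^{1/2}])\big)^{1/2}$. For $\nu,\mu$ with full support, $H_{\mathscr{F}_{n+1}}(\nu,\mu)(\omega)$ denotes $H(P,Q)$ where $P,Q$ are the restrictions to $\mathscr{F}_{n+1}$ of the conditional measures $\nu(\cdot\mid[\omega\upharpoonright n])$ and $\mu(\cdot\mid[\omega\upharpoonright n])$, respectively. $\nu\ll_{comp}\mu$ iff there is a computable function $m:\mathbb{Q}^{>0}\to\mathbb{Q}^{>0}$ such that for all rationals $\epsilon>0$ and all Borel $A\subseteq 2^{\mathbb{N}}$, if $\mu(A)<m(\epsilon)$ then $\nu(A)<\epsilon$. $\mathsf{MR}^{\nu}_2(\ll_{comp},\mathscr{F}_{n+1},H)$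 is the set of $\omega\in2^{\mathbb{N}}$ such that for all computable probability measures $\mu$ with full support and $\nu\ll_{comp}\mu$, one has $\sum_n \big(H_{\mathscr{F}_{n+1}}(\nu,\mu)(\omega)\big)^2<\infty$. A c.e. open set is one of the form $\bigcup_n[\sigma_n]$ for a computable sequence $\sigma_n$ of binary strings. $\mathsf{MLR}^{\nu}$ (Martin-Löf $\nu$-random points) is the set of $\omega$ such that $\omega\notin\bigcap_n U_n$ for every computable sequence $U_n$ of c.e. opens with $\nu(U_n)\le 2^{-n}$ for all $n\ge 0$. *)

(* Defs.v *)
From HB Require Import structures.
From mathcomp Require Import all_boot all_order all_algebra.
From mathcomp Require Import all_classical all_reals all_analysis.

Set Implicit Arguments.
Unset Strict Implicit.
Unset Printing Implicit Defensive.

Import Order.TTheory GRing.Theory Num.Theory.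

Local Open Scope classical_set_scope.
Local Open Scope charge_scope.
Local Open Scope ring_scope.

(* Kleene's general recursive functions. Minimization is applied only when the
   search succeeds on every input, so that all functions are total; by Kleene's
   normal form theorem these are exactly the total computable functions. *)
Inductive general_recursive : forall n, (n.-tuple nat -> nat) -> Prop :=
| rec_zero : general_recursive (fun _ : 0.-tuple nat => 0%N)
| rec_succ : general_recursive (fun v : 1.-tuple nat => (thead v).+1)
| rec_proj n (i : 'I_n) : general_recursive (fun v : n.-tuple nat => tnth v i)
| rec_comp m n (g : m.-tuple nat -> nat) (h : 'I_m -> n.-tuple nat -> nat) :
    general_recursive g -> (forall i, general_recursive (h i)) ->
    general_recursive (fun v => g [tuple h i v | i < m])
| rec_primrec n (g : n.-tuple nat -> nat) (h : n.+2.-tuple nat -> nat)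
    (f : n.+1.-tuple nat -> nat) :
    general_recursive g -> general_recursive h ->
    (forall v : n.-tuple nat, f [tuple of 0%N :: v] = g v) ->
    (forall k (v : n.-tuple nat), f [tuple of k.+1 :: v] =
                 h [tuple of k :: f [tuple of k :: v] :: v]) ->
    general_recursive f
| rec_min n (g : n.+1.-tuple nat -> nat) (f : n.-tuple nat -> nat) :
    general_recursive g ->
    (forall v : n.-tuple nat, g [tuple of f v :: v] = 0%N /\
               forall k, (k < f v)%N -> g [tuple of k :: v] <> 0%N) ->
    general_recursive f.

(* Values are coded by [pickle]. On the types used below, built from nat, bool
   and rat by pairs, sequences and decidable subtypes, it is an explicit
   elementary coding (see CodeSeq; a rational is coded by its reduced fraction)
   with a decidable range. For an arbitrary countType this would not be a
   meaningful notion of computability. *)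
Definition computable_fun (A B : countType) (f : A -> B) : Prop :=
  exists2 g : 1.-tuple nat -> nat, general_recursive g &
    forall a, g [tuple pickle a] = pickle (f a).

Definition cantor_borel := g_sigma_algebraType (@open cantor_space).

Definition cylinder (s : seq bool) : set cantor_space :=
  [set w | mkseq w (size s) = s].

Definition cylinders (n : nat) : set (set cantor_space) :=
  cylinder @` [set s | size s = n].

Definition cantor_sub (n : nat) := g_sigma_algebraType (cylinders n).

Lemma open_cylinder s : open (cylinder s).
Proof.
rewrite openE => w; rewrite /cylinder /interior /= => <-.
rewrite size_mkseq; elim: (size s) => [|n IHn].
  by apply: filterE => v; rewrite /mkseq.
have wn : nbhs w [set v : cantor_space | v n = w n].
  apply: (@proj_continuous nat (fun=> bool) n w [set w n]).
  by apply: open_nbhs_nbhs; split => //; exact: discrete_open.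
by apply: filterS2 IHn wn => v /= IH vn; rewrite !mkseqS IH vn.
Qed.

Lemma measurable_cylinder s : measurable (cylinder s : set cantor_borel).
Proof. by apply: sub_sigma_algebra; exact: open_cylinder. Qed.

Definition to_sub (n : nat) (w : cantor_borel) : cantor_sub n := w.

Lemma measurable_to_sub n : measurable_fun [set: cantor_borel] (@to_sub n).
Proof.
apply: (@measurability _ _ cantor_borel (cantor_sub n) setT (@to_sub n)
  (cylinders n)) => // _ [_ [s _ <-] <-].
by rewrite setTI; exact: measurable_cylinder.
Qed.

HB.instance Definition _ n :=
  isMeasurableFun.Build _ _ cantor_borel (cantor_sub n) (@to_sub n)
    (@measurable_to_sub n).

(* Meant for P `<< Q: otherwise the Radon-Nikodym derivative is a junk value. *)
Definition hellinger d (T : measurableType d) (R : realType)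
    (P Q : probability T R) : R :=
  Num.sqrt (2 * (1 - fine
    'E_Q[fun x => Num.sqrt (fine (('d (charge_of_finite_measure P) '/d Q) x))])).

(* The restriction of nu to the sub-sigma-algebra of cantor_sub n is its image
   under the identity. *)
Definition restriction (R : realType) (n : nat) (nu : probability cantor_borel R)
    : set (cantor_sub n) -> \bar R :=
  distribution nu (@to_sub n).
Arguments restriction {R} n nu _.

HB.instance Definition _ (R : realType) n (nu : probability cantor_borel R) :=
  Probability.on (restriction n nu).

Section measures_on_cantor_space.
Variable R : realType.
Implicit Types nu mu : probability cantor_borel R.

Definition computable_measure nu : Prop :=
  exists2 q : seq bool * nat -> rat, computable_fun q &
    forall s k, `|fine (nu (cylinder s)) - ratr (q (s, k))| <= 2 ^- k.

Definition full_support nu : Prop := forall s, (0 < nu (cylinder s))%E.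

(* nu( . | [s]); the second argument of mnormalize is a default value, which is
   used only if nu [s] = 0. *)
Definition conditional nu (s : seq bool) : set cantor_borel -> \bar R :=
  mnormalize (mrestr nu (measurable_cylinder s)) nu.

HB.instance Definition _ nu s := Probability.on (conditional nu s).

Definition hellinger_step nu mu (n : nat) (w : cantor_space) : R :=
  hellinger (restriction n.+1 (conditional nu (mkseq w n)))
            (restriction n.+1 (conditional mu (mkseq w n))).

Definition posrat := {q : rat | 0 < q}.

Definition dominates_comp nu mu : Prop :=
  exists2 m : posrat -> posrat, computable_fun m &
    forall (e : posrat) (A : set cantor_borel), measurable A ->
      (mu A < (ratr (val (m e)))%:E)%E -> (nu A < (ratr (val e))%:E)%E.

Definition MR2 nu : set cantor_space :=
  [set w | forall mu, computable_measure mu -> full_support mu ->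
    dominates_comp nu mu ->
    (\sum_(0 <= n <oo) ((hellinger_step nu mu n w) ^+ 2)%:E < +oo)%E].

Definition computable_ce_open_seq (U : nat -> set cantor_space) : Prop :=
  exists2 s : nat * nat -> seq bool, computable_fun s &
    forall n, U n = \bigcup_k cylinder (s (n, k)).

Definition MLR nu : set cantor_space :=
  [set w | forall U, computable_ce_open_seq U ->
    (forall n, (nu (U n) <= (2 ^- n)%:E)%E) -> ~ (\bigcap_n U n) w].

End measures_on_cantor_space.

(* Main.v *)
(* Put n = nu[s], m = mu[s] along the prefixes s of w, X = m / n, and let
   increment s be the conditional nu-expectation, given [s], of the next
   increment of the nu-submartingale 1 / (1 + X) = n / (n + m). Exact Taylor
   expansion makes it a rational function of the measures of s, s0 and s1, the
   increments have total nu-expectation at most 1, and while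
   1/c <= X <= c the squared Hellinger step is at most 4 c^3 increment s.
   Three Martin-Loef tests, each estimated by Ville's inequality, then bound
   along a nu-random w: X (as the nu-martingale mu/nu), 1/X (as the
   mu-martingale nu/mu, transferred to nu by computable domination), and the
   sum of the increments. Replacing the Hellinger distance by this rational
   quantity keeps every test decidable in integer arithmetic on dyadic
   approximations of the measures. *)
Require Import Defs.
From mathcomp Require Import all_boot all_order all_algebra.
From mathcomp Require Import all_classical all_reals all_analysis.
From mathcomp Require Import measurable_realfun.
From mathcomp Require Import zify ring lra.

Set Implicit Arguments.
Unset Strict Implicit.
Unset Printing Implicit Defensive.
Import Order.TTheory GRing.Theory Num.Theory.
Import numFieldNormedType.Exports.

(** * Recursive functions on tuples of natural numbers *)

(** A test has to be enumerated by a total general recursive function, whereas order between reals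
    is undecidable. Each test is therefore a decidable predicate [T (k, s, j)] with a stage [j],
    computed from integer brackets of the measures at scale [2 ^ j]. Firing at one stage certifies
    that the tested quantity is large at [s], which bounds the measure of the test. Silence at every
    stage yields the opposite weak inequality, which bounds the quantity along a random point.
    Computability refers to codes, so it is built up from recursion on numbers through lists,
    integers and rationals. The function 1 / (1 + x) is convex with values in [0, 1] for x >= 0, so
    the total expected increase is finite. Its second derivative 2 / (1 + x)^3 is bounded below
    where x is bounded, so there the increments control the squared relative variation of X, and
    with it the squared Hellinger distance. The three tests do not refer to one another: the bounds
    on X and 1/X enter only in the final pointwise comparison, and no stopping time occurs. *)

Lemma general_recursive_ext n (f g : n.-tuple nat -> nat) :
  f =1 g -> general_recursive f -> general_recursive g.
Proof. by move=> /funext ->. Qed.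

Lemma rec_comp1 n (h : nat -> nat) (f : n.-tuple nat -> nat) :
  general_recursive (fun v : 1.-tuple nat => h (thead v)) ->
  general_recursive f -> general_recursive (fun v => h (f v)).
Proof.
move=> hh hf; apply: general_recursive_ext (rec_comp (h := fun=> f) hh _) => //.
by move=> v; rewrite /thead tnth_mktuple.
Qed.

Lemma rec_comp2 n (h : nat -> nat -> nat) (f1 f2 : n.-tuple nat -> nat) :
  general_recursive (fun v : 2.-tuple nat => h (thead v) (tnth v (inord 1))) ->
  general_recursive f1 -> general_recursive f2 ->
  general_recursive (fun v => h (f1 v) (f2 v)).
Proof.
move=> hh h1 h2.
apply: general_recursive_ext
  (rec_comp (h := fun i : 'I_2 => if i == ord0 then f1 else f2) hh _).
  have e : (inord 1 == ord0 :> 'I_2) = false by rewrite -val_eqE /= inordK.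
  by move=> v; rewrite /thead !tnth_mktuple eqxx e.
by move=> i; case: ifP.
Qed.

Lemma rec_const n k : general_recursive (fun _ : n.-tuple nat => k).
Proof.
elim: k => [|k IH]; last exact: (rec_comp1 rec_succ IH).
by apply: (rec_comp (h := fun (_ : 'I_0) _ => 0) rec_zero) => -[].
Qed.

(** Replaces the equations of [rec_primrec] by a closed term whose recursion length may itself
    depend on the parameters. *)
Lemma rec_nat_rec n (g : n.-tuple nat -> nat) (h : n.+2.-tuple nat -> nat)
    (k : n.-tuple nat -> nat) :
  general_recursive g -> general_recursive h -> general_recursive k ->
  general_recursive (fun v =>
    nat_rec (fun=> nat) (g v) (fun j r => h [tuple of j :: [tuple of r :: v]]) (k v)).
Proof.
move=> hg hh hk.
pose G (u : n.-tuple nat) : nat -> nat := nat_rec (fun=> nat) (g u)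
  (fun j r => h [tuple of j :: [tuple of r :: u]]).
pose F (v : n.+1.-tuple nat) := G [tuple of behead v] (thead v).
have FE x (v : n.-tuple nat) : F [tuple of x :: v] = G v x by congr (G _ _); exact: val_inj.
have hF : general_recursive F.
  by apply: (rec_primrec hg hh) => [v|j v]; rewrite !FE.
(* [F] is composed with [k] at index 0 and with the projections at the other indices; [unlift ord0]
   separates the two cases. *)
apply: general_recursive_ext
  (rec_comp (h := fun i : 'I_n.+1 => if unlift ord0 i is Some j
                   then fun v => tnth v j else k) hF _).
  move=> v; rewrite /F /thead tnth_mktuple unlift_none -/(G v _).
  suff -> : [tuple of behead [tuple (if unlift ord0 i is Some j
      then fun v0 : n.-tuple nat => tnth v0 j else k) v  | i < n.+1]] = v by [].
  apply: eq_from_tnth => i; rewrite tnth_behead tnth_mktuple.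
  have -> : inord i.+1 = lift ord0 i by apply: val_inj; rewrite /= inordK // ltnS.
  by rewrite liftK.
by move=> i; case: unliftP => [j _|_] //; exact: rec_proj.
Qed.

Notation rec1 h := (general_recursive (fun v : 1.-tuple nat => h (thead v))).
Notation rec2 h :=
  (general_recursive (fun v : 2.-tuple nat => h (thead v) (tnth v (inord 1)))).

Lemma rec2_nat_rec (h : nat -> nat -> nat) (g : nat -> nat) (k : nat -> nat -> nat) :
  rec1 g -> rec2 k -> (forall x y, h x y = nat_rec (fun=> nat) (g y) (fun _ r => k r y) x) ->
  rec2 h.
Proof.
move=> hg hk E.
apply: (general_recursive_ext (f := fun v : 2.-tuple nat => _)); last first.
  (* The step receives the counter, the value so far, [x] and [y], in this order; hence the indices
     1 and 3. *)
  apply: (@rec_nat_rec _ (fun v => g (tnth v (inord 1)))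
    (fun v => k (tnth v (inord 1)) (tnth v (inord 3))) (fun v => thead v)).
  - by apply: (rec_comp1 hg); exact: rec_proj.
  - by apply: (rec_comp2 hk); exact: rec_proj.
  - exact: rec_proj.
move=> v /=; rewrite E; elim: (thead v) => //= j ->.
by rewrite !(tnth_nth 0) /= !inordK //=.
Qed.

Lemma rec2_addn : rec2 addn.
Proof.
apply: (rec2_nat_rec (g := id) (k := fun r _ => r.+1)).
- exact: rec_proj.
- by apply: (rec_comp1 rec_succ); exact: rec_proj.
- by elim=> //= x IH y; rewrite addSn IH.
Qed.

Lemma rec2_muln : rec2 muln.
Proof.
apply: (rec2_nat_rec (g := fun=> 0) (k := addn)).
- exact: rec_const.
- exact: rec2_addn.
- by elim=> //= x IH y; rewrite mulSn IH addnC.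
Qed.

Lemma rec2_flip h : rec2 h -> rec2 (fun x y => h y x).
Proof. by move=> hh; apply: (rec_comp2 hh); exact: rec_proj. Qed.

Lemma rec2_expn : rec2 expn.
Proof.
suff H : rec2 (fun x y => y ^ x) by exact: (rec2_flip (h := fun x y => y ^ x) H).
apply: (rec2_nat_rec (h := fun x y => y ^ x) (g := fun=> 1) (k := muln)).
- exact: rec_const.
- exact: rec2_muln.
- by elim=> //= x IH y; rewrite expnSr IH.
Qed.

Lemma rec1_predn : rec1 predn.
Proof.
(* A step that forgets the previous value and returns the counter computes the predecessor. *)
have H := rec_nat_rec (rec_const 1 0) (rec_proj ord0) (rec_proj ord0).
by apply: general_recursive_ext H => v /=; rewrite /thead; case: (tnth v _).
Qed.

Lemma rec2_subn : rec2 subn.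
Proof.
suff H : rec2 (fun x y => y - x) by exact: (rec2_flip (h := fun x y => y - x) H).
apply: (rec2_nat_rec (h := fun x y => y - x) (g := id) (k := fun x _ => x.-1)).
- exact: rec_proj.
- by apply: (rec_comp1 rec1_predn); exact: rec_proj.
- by elim=> [|x IH] y /=; rewrite ?subn0 // -IH subnS.
Qed.

Lemma rec_leq n (f g : n.-tuple nat -> nat) :
  general_recursive f -> general_recursive g ->
  general_recursive (fun v => nat_of_bool (f v <= g v)).
Proof.
move=> hf hg; apply: (general_recursive_ext (f := fun v => 1 - (f v - g v))).
  by move=> v; rewrite -subn_eq0; case: (f v - g v).
apply: (rec_comp2 rec2_subn); first exact: rec_const.
exact: (rec_comp2 rec2_subn).
Qed.

Lemma rec_search n (P : n.+1.-tuple nat -> bool) (f : n.-tuple nat -> nat) :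
  general_recursive (fun v => nat_of_bool (P v)) ->
  (forall v : n.-tuple nat, P [tuple of f v :: v]) ->
  (forall (v : n.-tuple nat) k, P [tuple of k :: v] -> f v <= k) -> general_recursive f.
Proof.
move=> hP Pf fmin.
apply: (rec_min (g := fun v => 1 - P v)).
  exact: (rec_comp2 rec2_subn (rec_const _ 1) hP).
move=> v; rewrite Pf; split=> // k kf; case: (boolP (P _)) => // /fmin.
by rewrite leqNgt kf.
Qed.

Lemma rec2_divn : rec2 divn.
Proof.
(* The second summand makes the search succeed at once for divisor 0. *)
pose P (v : 3.-tuple nat) := tnth v (inord 1) <
  (tnth v (inord 0)).+1 * tnth v (inord 2) + (1 - tnth v (inord 2)) * (tnth v (inord 1)).+1.
apply: (@rec_search _ P).
- apply: rec_leq.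
    by apply: (rec_comp1 rec_succ); exact: rec_proj.
  apply: (rec_comp2 rec2_addn); apply: (rec_comp2 rec2_muln).
  + by apply: (rec_comp1 rec_succ); exact: rec_proj.
  + exact: rec_proj.
  + by apply: (rec_comp2 rec2_subn); [exact: rec_const|exact: rec_proj].
  + by apply: (rec_comp1 rec_succ); exact: rec_proj.
- move=> v; rewrite /P /thead !(tnth_nth 0) /= !inordK //=.
  case: (nth 0 v 1) => [|d]; first by rewrite muln0 add0n subn0 mul1n.
  by rewrite addn0 ltn_ceil.
- move=> v k; rewrite /P /thead !(tnth_nth 0) /= !inordK //=.
  case: (nth 0 v 1) => [|d]; first by rewrite divn0.
  by rewrite addn0 -ltn_divLR.
Qed.

(** * Computable functions on coded types *)

Lemma computable_funP (A B : countType) (f : A -> B) :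
  computable_fun f <->
  exists2 h : nat -> nat, rec1 h & forall a, h (pickle a) = pickle (f a).
Proof.
split=> [[g hg E]|[h hh E]].
  exists (fun x => g [tuple x]) => //; apply: general_recursive_ext hg => v.
  by congr g; apply: eq_from_tnth => i; rewrite (ord1 i).
by exists (fun v => h (thead v)).
Qed.

(** Computability depends only on codes, so a function may be replaced by one into another type
    whose values have the same codes. *)
Lemma computable_pickle (A B C : countType) (f : A -> B) (g : A -> C) :
  (forall a, pickle (f a) = pickle (g a)) -> computable_fun f -> computable_fun g.
Proof. by move=> E [h hh hE]; exists h => // a; rewrite hE. Qed.

Lemma computable_id (A : countType) : computable_fun (@id A).
Proof. by apply/computable_funP; exists id => //; exact: rec_proj. Qed.

Lemma computable_const (A B : countType) (b : B) : computable_fun (fun _ : A => b).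
Proof. by apply/computable_funP; exists (fun=> pickle b) => //; exact: rec_const. Qed.

Lemma computable_comp (A B C : countType) (f : B -> C) (g : A -> B) :
  computable_fun f -> computable_fun g -> computable_fun (fun a => f (g a)).
Proof.
move=> /computable_funP[f' hf Ef] /computable_funP[g' hg Eg].
apply/computable_funP; exists (fun x => f' (g' x)); first exact: (rec_comp1 hf).
by move=> a; rewrite Eg Ef.
Qed.

Lemma computable_op2 (A B C D : countType) (h : nat -> nat -> nat) (F : B -> C -> D)
    (f : A -> B) (g : A -> C) :
  rec2 h -> (forall b c, h (pickle b) (pickle c) = pickle (F b c)) ->
  computable_fun f -> computable_fun g -> computable_fun (fun a => F (f a) (g a)).
Proof.
move=> hh hE /computable_funP[f' hf Ef] /computable_funP[g' hg Eg].
apply/computable_funP; exists (fun x => h (f' x) (g' x)).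
  exact: (rec_comp2 hh).
by move=> a; rewrite Eg Ef.
Qed.

(** The step of the coding of sequences behind [pickle]: the empty list has code 0, and a pair is
    coded like a list of two entries. *)
Definition cons_code x y := 2 ^ x * y.*2.+1.
Definition head_code n := logn 2 n.
Definition behead_code n := n %/ 2 ^ logn 2 n %/ 2.

Lemma head_codeK x y : head_code (cons_code x y) = x.
Proof.
rewrite /head_code lognM ?expn_gt0 // pfactorK // logn_coprime ?addn0 //.
by rewrite coprime2n /= odd_double.
Qed.

Lemma behead_codeK x y : behead_code (cons_code x y) = y.
Proof.
rewrite /behead_code -/(head_code _) head_codeK mulKn ?expn_gt0 //.
by rewrite divn2 /= uphalf_double.
Qed.

Lemma rec2_cons_code : rec2 cons_code.
Proof.
apply: (rec_comp2 rec2_muln).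
  by apply: (rec_comp2 rec2_expn); [exact: rec_const|exact: rec_proj].
apply: (rec_comp1 rec_succ).
apply: (general_recursive_ext (f := fun v : 2.-tuple nat => tnth v (inord 1) * 2)).
  by move=> v; rewrite muln2.
by apply: (rec_comp2 rec2_muln); [exact: rec_proj|exact: rec_const].
Qed.

Lemma rec1_head_code : rec1 head_code.
Proof.
(* The least [k] such that [2 ^ k.+1] does not divide the argument. The summand [1 - n] ends the
   search at 0 when the argument is 0, in accordance with [logn 2 0 = 0]. *)
pose P (v : 2.-tuple nat) := tnth v (inord 1) %/ 2 ^ (thead v).+1 * 2 ^ (thead v).+1
   < tnth v (inord 1) + (1 - tnth v (inord 1)).
have e (x : nat) (v : 1.-tuple nat) : (thead [tuple of x :: v] = x) *
    (tnth [tuple of x :: v] (inord 1) = thead v).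
  by rewrite /thead !(tnth_nth 0) /= inordK.
apply: (@rec_search _ P).
- have hX : general_recursive (fun v : 2.-tuple nat => 2 ^ (thead v).+1).
    apply: (rec_comp2 rec2_expn); first exact: rec_const.
    by apply: (rec_comp1 rec_succ); exact: rec_proj.
  apply: rec_leq.
    apply: (rec_comp1 rec_succ); apply: (rec_comp2 rec2_muln) => //.
    by apply: (rec_comp2 rec2_divn) => //; exact: rec_proj.
  apply: (rec_comp2 rec2_addn); first exact: rec_proj.
  by apply: (rec_comp2 rec2_subn); [exact: rec_const|exact: rec_proj].
- move=> v; rewrite /P !e; case: (posnP (thead v)) => [->|n0].
    by rewrite div0n mul0n.
  rewrite (_ : 1 - _ = 0) ?addn0; last by apply/eqP; rewrite subn_eq0.
  rewrite ltn_neqAle leq_trunc_div andbT -dvdn_eq /head_code.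
  by rewrite pfactor_dvdn // ltnn.
- move=> v k; rewrite /P !e; case: (posnP (thead v)) => [->|n0].
    by rewrite /head_code logn0.
  rewrite (_ : 1 - _ = 0) ?addn0; last by apply/eqP; rewrite subn_eq0.
  rewrite ltn_neqAle leq_trunc_div andbT -dvdn_eq /head_code.
  by rewrite pfactor_dvdn // -leqNgt.
Qed.

Lemma rec1_behead_code : rec1 behead_code.
Proof.
apply: (rec_comp2 rec2_divn); last exact: rec_const.
apply: (rec_comp2 rec2_divn); first exact: rec_proj.
apply: (rec_comp2 rec2_expn); first exact: rec_const.
exact: rec1_head_code.
Qed.

Lemma computable_cons (A B : countType) (f : A -> B) (g : A -> seq B) :
  computable_fun f -> computable_fun g -> computable_fun (fun a => f a :: g a).
Proof. exact: (computable_op2 rec2_cons_code). Qed.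

Lemma computable_behead (A : countType) : computable_fun (@behead A).
Proof.
apply/computable_funP; exists behead_code; first exact: rec1_behead_code.
by case=> [|x s] //; exact: behead_codeK.
Qed.

Lemma computable_pair (A B C : countType) (f : A -> B) (g : A -> C) :
  computable_fun f -> computable_fun g -> computable_fun (fun a => (f a, g a)).
Proof.
apply: (computable_op2 (h := fun x y => cons_code x (cons_code y 0))) => //.
apply: (rec_comp2 rec2_cons_code); first exact: rec_proj.
by apply: (rec_comp2 rec2_cons_code); [exact: rec_proj|exact: rec_const].
Qed.

Lemma computable_fst (A B : countType) : computable_fun (@fst A B).
Proof.
apply/computable_funP; exists head_code; first exact: rec1_head_code.
by move=> [a b]; exact: head_codeK.
Qed.

Lemma computable_snd (A B : countType) : computable_fun (@snd A B).
Proof.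
apply/computable_funP; exists (fun x => head_code (behead_code x)).
  exact: (rec_comp1 rec1_head_code rec1_behead_code).
move=> [a b]; rewrite [X in behead_code X](_ : _ =
  cons_code (pickle a) (cons_code (pickle b) 0)) //.
by rewrite behead_codeK head_codeK.
Qed.

Lemma computable_addn (A : countType) (f g : A -> nat) :
  computable_fun f -> computable_fun g -> computable_fun (fun a => f a + g a).
Proof. exact: (computable_op2 rec2_addn). Qed.

Lemma computable_muln (A : countType) (f g : A -> nat) :
  computable_fun f -> computable_fun g -> computable_fun (fun a => f a * g a).
Proof. exact: (computable_op2 rec2_muln). Qed.

Lemma computable_subn (A : countType) (f g : A -> nat) :
  computable_fun f -> computable_fun g -> computable_fun (fun a => f a - g a).
Proof. exact: (computable_op2 rec2_subn). Qed.

Lemma computable_divn (A : countType) (f g : A -> nat) :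
  computable_fun f -> computable_fun g -> computable_fun (fun a => f a %/ g a).
Proof. exact: (computable_op2 rec2_divn). Qed.

Lemma computable_expn (A : countType) (f g : A -> nat) :
  computable_fun f -> computable_fun g -> computable_fun (fun a => f a ^ g a).
Proof. exact: (computable_op2 rec2_expn). Qed.

Lemma computable_leq (A : countType) (f g : A -> nat) :
  computable_fun f -> computable_fun g -> computable_fun (fun a => f a <= g a).
Proof.
apply: (computable_op2 (h := fun x y => x <= y)); last by move=> x y; case: leq.
by apply: rec_leq; exact: rec_proj.
Qed.

Lemma computable_if (A B : countType) (b : A -> bool) (f g : A -> B) :
  computable_fun b -> computable_fun f -> computable_fun g ->
  computable_fun (fun a => if b a then f a else g a).
Proof.
move=> /computable_funP[b' hb Eb] /computable_funP[f' hf Ef].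
move=> /computable_funP[g' hg Eg]; apply/computable_funP.
exists (fun x => b' x * f' x + (1 - b' x) * g' x).
  apply: (rec_comp2 rec2_addn); apply: (rec_comp2 rec2_muln) => //.
  by apply: (rec_comp2 rec2_subn) => //; exact: rec_const.
move=> a; rewrite Eb Ef Eg; case: (b a) => /=.
  by rewrite mul1n addn0.
by rewrite mul1n.
Qed.

Lemma computable_iter (A B : countType) (z : A -> B) (h : A -> B -> B)
    (n : A -> nat) :
  computable_fun z -> computable_fun (fun p : A * B => h p.1 p.2) ->
  computable_fun n -> computable_fun (fun a => iter (n a) (h a) (z a)).
Proof.
move=> /computable_funP[z' hz Ez] /computable_funP[h' hh Eh].
move=> /computable_funP[n' hn En]; apply/computable_funP.
pose H (v : 3.-tuple nat) :=
  h' (cons_code (tnth v (inord 2)) (cons_code (tnth v (inord 1)) 0)).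
have hH : general_recursive H.
  apply: (rec_comp1 hh); apply: (rec_comp2 rec2_cons_code); first exact: rec_proj.
  by apply: (rec_comp2 rec2_cons_code); [exact: rec_proj|exact: rec_const].
exists (fun x => nat_rec (fun=> nat) (z' x)
  (fun _ r => h' (cons_code x (cons_code r 0))) (n' x)).
  apply: general_recursive_ext (rec_nat_rec hz hH hn) => v.
  elim: (n' _) => //= j ->.
  by rewrite /H /thead !(tnth_nth 0) /= !inordK //=.
move=> a; rewrite En [pickle (n a)]/=.
elim: (n a) => [|k IH]; first exact: Ez.
by rewrite iterS -(Eh (a, _)) /= IH.
Qed.

(* The parameter is a number: on arguments that code no value a search need not
   terminate, but [rec_min] only allows total searches. *)
Lemma computable_search (P : nat -> nat -> bool) (f : nat -> nat) :
  computable_fun (fun p : nat * nat => P p.1 p.2) ->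
  (forall n, P n (f n)) -> (forall n k, P n k -> f n <= k) -> computable_fun f.
Proof.
move=> /computable_funP[P' hP EP] Pf fmin; apply/computable_funP; exists f => //.
apply: (@rec_search _ (fun v => P (tnth v (inord 1)) (thead v))).
- apply: (general_recursive_ext (f := fun v : 2.-tuple nat =>
    P' (cons_code (tnth v (inord 1)) (cons_code (thead v) 0)))) => [v|].
    by rewrite (EP (_, _)); case: (P _ _).
  apply: (rec_comp1 hP); apply: (rec_comp2 rec2_cons_code); first exact: rec_proj.
  by apply: (rec_comp2 rec2_cons_code); [exact: rec_proj|exact: rec_const].
- by move=> v; rewrite /thead !(tnth_nth 0) /= inordK //=; exact: Pf.
- by move=> v k; rewrite /thead !(tnth_nth 0) /= inordK //=; exact: fmin.
Qed.

Lemma computable_head (A : countType) (x0 : A) : computable_fun (head x0).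
Proof.
have h1 : computable_fun (fun s : seq A => pickle s).
  by apply: computable_pickle (@computable_id _).
apply: (@computable_pickle _ _ _ (fun s : seq A => if pickle s <= 0 then pickle x0 else
   head_code (pickle s))).
  by case=> [|x s] //=; rewrite leqn0 muln_eq0 expn_eq0 /= head_codeK.
apply: computable_if; first by apply: computable_leq => //; exact: computable_const.
  exact: computable_const.
apply: computable_comp h1; apply/computable_funP.
by exists head_code => //; exact: rec1_head_code.
Qed.

(** The code of a list exceeds the code of its tail, so it bounds the length and serves as the
    number of iterations; once the list is empty the step does nothing. *)
Lemma computable_foldl (A B X : countType) (x0 : X) (f : A -> B -> X -> B)
    (z : A -> B) (s : A -> seq X) :
  computable_fun (fun p : A * (B * X) => f p.1 p.2.1 p.2.2) ->
  computable_fun z -> computable_fun s ->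
  computable_fun (fun a => foldl (f a) (z a) (s a)).
Proof.
move=> hf hz hs.
pose step a (t : seq X * B) := if pickle t.1 <= 0 then t else
  (behead t.1, f a t.2 (head x0 t.1)).
have E a t k : pickle t.1 <= k -> (iter k (step a) t).2 = foldl (f a) t.2 t.1.
  elim: k t => [|k IH] [l b].
    by case: l => //= x l; rewrite leqn0 muln_eq0 expn_eq0.
  case: l => [|x l] le; first by rewrite iterSr [step _ _]/step /= IH.
  have kE : pickle (x :: l) = 2 ^ pickle x * (pickle l).*2.+1 by [].
  have k0 : (pickle (x :: l) <= 0) = false by rewrite kE leqn0 muln_eq0 expn_eq0.
  rewrite iterSr [step _ _]/step k0 IH //= -ltnS; apply: leq_trans le; rewrite kE.
  apply: (@leq_trans (1 * (pickle l).*2.+1)); last by rewrite leq_mul2r expn_gt0.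
  by rewrite mul1n ltnS -addnn leq_addr.
apply: (@computable_pickle _ _ _
  (fun a => (iter (pickle (s a)) (step a) (s a, z a)).2)).
  by move=> a; rewrite E.
apply: (computable_comp (@computable_snd _ _)); apply: computable_iter.
- exact: computable_pair.
- have c2 : computable_fun (fun p : A * (seq X * B) => p.2) by exact: computable_snd.
  have c21 : computable_fun (fun p : A * (seq X * B) => p.2.1).
    exact: (computable_comp (@computable_fst _ _)).
  apply: computable_if => //.
    apply: computable_leq; last exact: computable_const.
    by apply: computable_pickle c21.
  apply: computable_pair; first exact: (computable_comp (@computable_behead _)).
  apply: (@computable_comp _ _ _ (fun p : A * (B * X) => f p.1 p.2.1 p.2.2)
    (fun p : A * (seq X * B) => (p.1, (p.2.2, head x0 p.2.1)))) => //.
  apply: computable_pair; first exact: computable_fst.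
  apply: computable_pair; first exact: (computable_comp (@computable_snd _ _)).
  exact: (computable_comp (computable_head x0)).
- by apply: computable_pickle hs.
Qed.

Lemma computable_succ (A : countType) (f : A -> nat) :
  computable_fun f -> computable_fun (fun a => (f a).+1).
Proof.
move=> hf; apply: (@computable_comp _ _ _ S) => //.
by exists (fun v => (thead v).+1) => //; exact: rec_succ.
Qed.

Lemma computable_rev (X : countType) (x0 : X) : computable_fun (@rev X).
Proof.
have E t : rev t = foldl (fun (l : seq X) x => x :: l) [::] t.
  by rewrite /rev; elim: t [::] => //= x t IH l; rewrite IH.
apply: (@computable_pickle _ _ _
    (fun t => foldl (fun (l : seq X) x => x :: l) [::] t)) => [a|]; first by rewrite E.
apply: (computable_foldl x0 (f := fun _ l x => x :: l)).
- apply: computable_cons.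
    exact: (computable_comp (@computable_snd _ _) (@computable_snd _ _)).
  exact: (computable_comp (@computable_fst _ _) (@computable_snd _ _)).
- exact: computable_const.
- exact: computable_id.
Qed.

Lemma computable_rcons (A X : countType) (f : A -> seq X) (g : A -> X) :
  computable_fun f -> computable_fun g -> computable_fun (fun a => rcons (f a) (g a)).
Proof.
(* [computable_rev] asks for an element of [X]; a value of [g] provides it, and on an empty [A] any
   recursive function is a witness. *)
move=> hf hg; have [a0|E] := pselect (inhabited A); last first.
  by exists (fun=> 0) => [|a]; [exact: rec_const | case: E; exists].
case: a0 => a0; have x0 := g a0.
apply: (@computable_pickle _ _ _ (fun a => rev (g a :: rev (f a)))) => [a|].
  by rewrite rev_cons revK.
apply: (computable_comp (computable_rev x0)); apply: computable_cons => //.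
exact: (computable_comp (computable_rev x0)).
Qed.

Lemma computable_map (A B : countType) (x0 : A) (f : A -> B) :
  computable_fun f -> computable_fun (map f).
Proof.
move=> hf; have E (z : seq B) s :
    foldl (fun l x => rcons l (f x)) z s = z ++ map f s.
  by elim: s z => [|x s IH] z /=; rewrite ?cats0 // IH cat_rcons.
apply: (@computable_pickle _ _ _ (fun s => foldl (fun l x => rcons l (f x)) [::] s)).
  by move=> s; rewrite E.
apply: (computable_foldl x0 (f := fun _ l x => rcons l (f x))).
- apply: computable_rcons.
    exact: (computable_comp (@computable_fst _ _) (@computable_snd _ _)).
  apply: (computable_comp hf).
  exact: (computable_comp (@computable_snd _ _) (@computable_snd _ _)).
- exact: computable_const.
- exact: computable_id.
Qed.

(** The fold carries the prefix read so far along with the partial sum. This computes sums of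
    increments along the prefixes of a string. *)
Lemma computable_prefix_sum (A X : countType) (x0 : X) (h : A -> seq X -> nat)
    (s : A -> seq X) :
  computable_fun (fun p : A * seq X => h p.1 p.2) -> computable_fun s ->
  computable_fun (fun a => \sum_(i < size (s a)) h a (take i (s a))).
Proof.
move=> hh hs.
pose step a (t : seq X * nat) x := (rcons t.1 x, t.2 + h a t.1).
have E a t : foldl (step a) ([::], 0) t =
    (t, \sum_(i < size t) h a (take i t)).
  elim/last_ind: t => [|t x IH]; first by rewrite big_ord0.
  rewrite foldl_rcons IH /step /= size_rcons big_ord_recr /=.
  congr (_, _ + _); last by rewrite -cats1 take_size_cat.
  by apply: eq_bigr => i _; rewrite -cats1 takel_cat // ltnW.
apply: (@computable_pickle _ _ _
  (fun a => (foldl (step a) ([::], 0) (s a)).2)) => [a|]; first by rewrite E.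
apply: (computable_comp (@computable_snd _ _)); apply: (computable_foldl x0) => //.
- have c2 := @computable_snd A (seq X * nat * X)%type.
  have c21 : computable_fun (fun p : A * (seq X * nat * X) => p.2.1).
    exact: (computable_comp (@computable_fst _ _) c2).
  have c211 := computable_comp (@computable_fst _ _) c21.
  apply: computable_pair.
    by apply: computable_rcons => //; exact: (computable_comp (@computable_snd _ _) c2).
  apply: computable_addn; first exact: (computable_comp (@computable_snd _ _) c21).
  apply: (computable_comp hh (g := fun p : A * (seq X * nat * X) => (p.1, p.2.1.1))).
  by apply: computable_pair => //; exact: computable_fst.
- exact: computable_const.
Qed.

(** * Integers, rationals and an enumeration of strings *)

Definition int_nat (z : int) : nat := if z is Posz n then n else 0.

(** A pair of lists with the same code as [z], which makes the list operations available for
    integers. *)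
Definition int_parts (z : int) : seq nat * seq nat :=
  match z with Posz n => ([:: n], [::]) | Negz n => ([::], [:: n]) end.

Lemma pickle_int_parts z : pickle (int_parts z) = pickle z.
Proof. by case: z. Qed.

Lemma computable_int_nat : computable_fun int_nat.
Proof.
apply: (@computable_pickle _ _ _ (fun z => head 0 (int_parts z).1)).
  by case.
apply: (computable_comp (computable_head 0)).
apply: (computable_comp (@computable_fst _ _)).
by apply: computable_pickle (@computable_id _) => z; rewrite pickle_int_parts.
Qed.

Lemma computable_Posz : computable_fun Posz.
Proof.
apply: (@computable_pickle _ _ _ (fun n => ([:: n], [::] : seq nat))) => [n //|].
apply: computable_pair; last exact: computable_const.
by apply: computable_cons; [exact: computable_id|exact: computable_const].
Qed.

Lemma computable_valq : computable_fun valq.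
Proof. by apply: computable_pickle (@computable_id _). Qed.

(** On codes this is the identity, since a number is its own code and a list of numbers is coded by
    [CodeSeq.code]. *)
Lemma computable_decode : computable_fun CodeSeq.decode.
Proof.
apply: computable_pickle (@computable_id _) => n.
by rewrite /= -[LHS]CodeSeq.decodeK; congr CodeSeq.code; rewrite map_id.
Qed.

(** Every number decodes to some list of numbers. The head is read as a stage and the tail as bits,
    nonzero meaning true, so the enumeration is total and hits every pair. *)
Definition string_enum (n : nat) : seq bool * nat :=
  (map (leq 1) (behead (CodeSeq.decode n)), head 0 (CodeSeq.decode n)).

Lemma computable_string_enum : computable_fun string_enum.
Proof.
rewrite /string_enum; apply: computable_pair; last first.
  exact: (computable_comp (computable_head 0) computable_decode).
apply: computable_comp; last first.
  exact: (computable_comp (@computable_behead _) computable_decode).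
apply: (computable_map 0); apply: computable_leq; last exact: computable_id.
exact: computable_const.
Qed.

Lemma string_enum_surj s k : exists n, string_enum n = (s, k).
Proof.
exists (CodeSeq.code (k :: map nat_of_bool s)).
rewrite /string_enum CodeSeq.codeK /=; congr (_, _).
by rewrite -map_comp map_id_in // => -[].
Qed.

Local Open Scope classical_set_scope.
Local Open Scope ring_scope.

(** * Cylinders and Ville's inequality *)

Lemma cylinder_nil : cylinder [::] = setT.
Proof. by apply/seteqP; split. Qed.

Lemma cylinder_rcons s b w :
  cylinder (rcons s b) w <-> cylinder s w /\ w (size s) = b.
Proof.
rewrite /cylinder /= size_rcons mkseqS; split=> [/rcons_inj[-> ->]//|[-> ->]//].
Qed.

Lemma cylinder_mkseq (w : cantor_space) n : cylinder (mkseq w n) w.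
Proof. by rewrite /cylinder /= size_mkseq. Qed.

Lemma cylinder_eq s w : cylinder s w -> s = mkseq w (size s).
Proof. by []. Qed.

Lemma measurable_bigcup_cylinder (B : set (seq bool)) :
  measurable (\bigcup_(s in B) cylinder s : set cantor_borel).
Proof.
apply: sub_sigma_algebra; apply: bigcup_open => s _; exact: open_cylinder.
Qed.

Section measure_of_cylinders.
Variable R : realType.
Implicit Types nu mu : probability cantor_borel R.

Definition weight nu (s : seq bool) : R := fine (nu (cylinder s)).

Lemma weightE nu s : nu (cylinder s) = (weight nu s)%:E.
Proof.
by rewrite fineK // fin_num_measure //; exact: measurable_cylinder.
Qed.

Lemma weight_ge0 nu s : 0 <= weight nu s.
Proof. exact: fine_ge0. Qed.

Lemma weight_gt0 nu : full_support nu -> forall s, 0 < weight nu s.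
Proof. by move=> H s; have := H s; rewrite weightE lte_fin. Qed.

Lemma weight_nil nu : weight nu [::] = 1.
Proof. by rewrite /weight cylinder_nil probability_setT. Qed.

Lemma weight_rcons nu s :
  weight nu s = weight nu (rcons s false) + weight nu (rcons s true).
Proof.
apply: EFin_inj; rewrite EFinD -!weightE -measureU.
- congr (nu _); apply/seteqP; split=> [w sw|w [] /cylinder_rcons[]//].
  by case E : (w (size s)); [right|left]; apply/cylinder_rcons.
- exact: measurable_cylinder.
- exact: measurable_cylinder.
- by apply/seteqP; split=> // w [/cylinder_rcons[_ e1] /cylinder_rcons[_]]; rewrite e1.
Qed.

Lemma small_weight nu n : exists s, weight nu s <= 2 ^- n.
Proof.
elim: n => [|n [s IH]]; first by exists [::]; rewrite weight_nil expr0 invr1.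
have [le|lt] := leP (weight nu (rcons s false)) (weight nu (rcons s true)).
- exists (rcons s false); rewrite exprS invfM.
  by have := weight_rcons nu s; lra.
- exists (rcons s true); rewrite exprS invfM.
  by have := weight_rcons nu s; lra.
Qed.

(* Ville's inequality; the bound is proved by induction on the depth, for the
   extensions in B of an arbitrary string. *)
Lemma ville nu (tau : seq bool -> R) (B : set (seq bool)) (c : R) :
  0 <= c -> (forall s, 0 <= tau s) ->
  (forall s, tau (rcons s false) + tau (rcons s true) <= tau s) ->
  (forall s, B s -> c * weight nu s <= tau s) ->
  (c%:E * nu (\bigcup_(s in B) cylinder s) <= (tau [::])%:E)%E.
Proof.
move=> c0 tau0 tauS tauB.
pose V n s := \bigcup_(t in [set t | [/\ B t, prefix s t & (size t <= size s + n)%N]])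
  cylinder t.
have mV n s : measurable (V n s : set cantor_borel).
  exact: measurable_bigcup_cylinder.
have VB n s : B s -> (c%:E * nu (V n s) <= (tau s)%:E)%E.
  move=> Bs; apply: (@le_trans _ _ (c%:E * nu (cylinder s))%E).
    apply: lee_wpmul2l; first by rewrite lee_fin.
    apply: le_measure; rewrite ?inE //; first exact: measurable_cylinder.
    move=> w [t [_ /prefixP[u ->] _]]; rewrite /cylinder /=.
    by rewrite size_cat /mkseq iotaD map_cat => /(congr1 (take (size s)));
      rewrite !take_size_cat ?size_map ?size_iota.
  by rewrite weightE -EFinM lee_fin; exact: tauB.
have VN n s : (c%:E * nu (V n s) <= (tau s)%:E)%E.
  elim: n s => [|n IH] s; have [Bs|nBs] := pselect (B s); try exact: VB.
    rewrite (_ : V 0%N s = set0) ?measure0 ?mule0 ?lee_fin //.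
    apply/seteqP; split=> // w [t [Bt /prefixP[u tE]]].
    rewrite tE size_cat addn0 -[X in (_ <= X)%N]addn0 leq_add2l leqn0.
    by move=> /nilP u0; move: Bt; rewrite tE u0 cats0.
  apply: (@le_trans _ _ (c%:E * (nu (V n (rcons s false)) + nu (V n (rcons s true))))%E).
    apply: lee_wpmul2l; first by rewrite lee_fin.
    apply: (@le_trans _ _ (nu (V n (rcons s false) `|` V n (rcons s true)))); last first.
      exact: measureU2.
    apply: le_measure; rewrite ?inE //; first exact: measurableU.
    move=> w [t [Bt /prefixP[[|b u] tE] szt]] tw.
      by case: nBs; move: Bt; rewrite tE cats0.
    have H : V n (rcons s b) w.
      exists t => //; split=> //; last by rewrite size_rcons addSnnS.
      by apply/prefixP; exists u; rewrite tE cat_rcons.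
    by case: b H {tE}; [right|left].
  rewrite ge0_muleDr ?measure_ge0 //; apply: le_trans (leeD (IH _) (IH _)) _.
  by rewrite -EFinD lee_fin.
have -> : \bigcup_(s in B) cylinder s = \bigcup_n V n [::].
  apply/seteqP; split=> [w [s Bs sw]|w [n _ [s [Bs _ _] sw]]]; last by exists s.
  by exists (size s) => //; exists s => //; split => //; rewrite prefix0s.
have cvgV : (fun n => c%:E * nu (V n [::]))%E @ \oo -->
    (c%:E * nu (\bigcup_n V n [::]))%E.
  apply: cvgeZl => //; apply: nondecreasing_cvg_mu => //.
    exact: bigcup_measurable.
  move=> m n mn; apply/subsetPset => w [s [Bs ps sz] sw]; exists s => //.
  by split=> //; rewrite (leq_trans sz) // leq_add2l.
rewrite -(cvg_lim _ cvgV) //; apply: lime_le; first by apply/cvg_ex; eexists; exact: cvgV.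
by apply: nearW => n; exact: VN.
Qed.

End measure_of_cylinders.

(** * Randomness tests *)

(** The approximation error and the rounding contribute at most one unit each at scale [2 ^ k]. A
    negative numerator is read as 0, which is harmless because [x] is nonnegative. *)
Lemma rat_floor_bounds (R : realType) (q : rat) (p k : nat) (x : R)
    (N := ((p * 2 ^ k) %/ int_nat (denq q))%N) :
  0 <= x -> p = int_nat (numq q) -> `|x - ratr q| <= 2 ^- k ->
  (N - 1)%:R <= 2 ^+ k * x <= (N + 2)%:R.
Proof.
move=> x0 pE xq.
have d0 : (0 < denq q)%R := denq_gt0 q.
have [d dE] : exists d, denq q = Posz d.+1.
  by case: (denq q) d0 => [[|d]|d] //; exists d.
have k0 : (0 : R) < 2 ^+ k by rewrite exprn_gt0.
have qE : ratr q = (numq q)%:~R / d.+1%:R :> R by rewrite /ratr dE.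
have d0' : (0 : R) < d.+1%:R by rewrite ltr0n.
have NE : N = ((p * 2 ^ k) %/ d.+1)%N by rewrite /N dE.
have Nl : (N * d.+1)%:R <= (p * 2 ^ k)%:R :> R by rewrite ler_nat NE leq_trunc_div.
have Nu : (p * 2 ^ k)%:R < (N.+1 * d.+1)%:R :> R by rewrite ltr_nat NE ltn_ceil.
have {xq} : `|2 ^+ k * x - 2 ^+ k * ratr q| <= 1.
  rewrite -mulrBr normrM gtr0_norm // (le_trans (ler_wpM2l (ltW k0) xq)) //.
  by rewrite divff // gt_eqF.
rewrite ler_distl => /andP[h1 h2].
have N1 : (N - 1)%:R <= Num.max 0 (N%:R - 1) :> R.
  by case: N {NE Nl Nu} => [|n]; rewrite ?le_max ?lexx // subn1 /= -natr1 addrK lexx orbT.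
case: (leP 0 (numq q)) => [n0|n0].
  have pE' : (numq q)%:~R = p%:R :> R.
    by rewrite pE; case: (numq q) n0.
  rewrite qE pE' in h1 h2.
  set y := _ * (_ / _) in h1 h2.
  have yE : y * d.+1%:R = (p * 2 ^ k)%:R.
    by rewrite /y natrM natrX; field; rewrite gt_eqF.
  have yl : N%:R <= y by rewrite -(ler_pM2r d0') yE -natrM.
  have yu : y <= N%:R + 1 by rewrite -(ler_pM2r d0') yE natr1 -natrM ltW.
  rewrite natrD; apply/andP; split; last by lra.
  apply: le_trans N1 _; rewrite ge_max mulr_ge0 ?(ltW k0) //=.
  by lra.
have N0 : N = 0%N by rewrite NE pE; case: (numq q) n0.
rewrite N0 mulr_ge0 ?(ltW k0) //=; rewrite qE in h2.
suff : 2 ^+ k * ((numq q)%:~R / d.+1%:R) <= 0 :> R.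
  move=> y0; apply: (le_trans h2).
  by rewrite (le_trans (lerD y0 (lexx 1))) // add0r ler1n.
by rewrite pmulr_rle0 // pmulr_lle0 ?invr_gt0 // lerz0 ltW.
Qed.

Section randomness_tests.
Variable R : realType.
Implicit Types nu mu : probability cantor_borel R.

Lemma computable_rat_floor (A : countType) (q : A -> rat) (k : A -> nat) :
  computable_fun q -> computable_fun k ->
  computable_fun (fun a => ((int_nat (numq (q a)) * 2 ^ k a) %/ int_nat (denq (q a)))%N).
Proof.
move=> hq hk; have hv := computable_comp computable_valq hq.
apply: computable_divn.
  apply: computable_muln.
    apply: (computable_comp computable_int_nat).
    exact: (computable_comp (@computable_fst _ _)).
  by apply: computable_expn => //; exact: computable_const.
apply: (computable_comp computable_int_nat).
exact: (computable_comp (@computable_snd _ _)).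
Qed.

(** Integer bounds at scale [2 ^ k]. The width 3, from N - 1 to N + 2 in [rat_floor_bounds], does
    not depend on [k], so it vanishes after division by the scale. *)
Definition brackets nu (lo hi : seq bool * nat -> nat) : Prop :=
  forall s k, [/\ (lo (s, k))%:R <= 2 ^+ k * weight nu s,
                  2 ^+ k * weight nu s <= (hi (s, k))%:R &
                  (hi (s, k) <= lo (s, k) + 3)%N].

Lemma nat_bounds nu : computable_measure nu ->
  exists lo hi : seq bool * nat -> nat,
    [/\ computable_fun lo, computable_fun hi & brackets nu lo hi].
Proof.
case=> q hq qE.
pose N a := ((int_nat (numq (q a)) * 2 ^ a.2) %/ int_nat (denq (q a)))%N.
have hN : computable_fun N.
  by apply: computable_rat_floor => //; exact: computable_snd.
exists (fun a => N a - 1)%N, (fun a => N a + 2)%N; split.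
- by apply: computable_subn => //; exact: computable_const.
- by apply: computable_addn => //; exact: computable_const.
- move=> s k; have /andP[h1 h2] :=
    rat_floor_bounds (k := k) (weight_ge0 nu s) erefl (qE s k).
  by split=> //; move: (N _) => n; lia.
Qed.

Lemma computable_small_string nu : computable_measure nu ->
  exists2 t : nat -> seq bool, computable_fun t & forall k, weight nu (t k) <= 2 ^- k.+1.
Proof.
move=> /nat_bounds[lo [hi [_ hhi H]]].
(* A string of measure at most [2 ^- (k + 3)] has lower bracket at most 1, hence upper bracket at
   most 4. Conversely an upper bracket of at most 4 at this scale gives measure at most
   [4 / 2 ^ (k + 3)], which is [2 ^- k.+1]. *)
have ex k : exists n, (hi ((string_enum n).1, k + 3) <= 4)%N.
  have [s hs] := small_weight nu (k + 3).
  have [n nE] := string_enum_surj s 0; exists n; rewrite nE /=.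
  have [h1 _ h2] := H s (k + 3)%N.
  apply: leq_trans h2 _; rewrite -[4%N]/(1 + 3)%N leq_add2r -(ler_nat R).
  apply: le_trans h1 _; apply: le_trans (ler_wpM2l _ hs) _ => //.
  by rewrite divff // expf_neq0.
pose t k := (string_enum (ex_minn (ex k))).1.
exists t.
  apply: (computable_comp (@computable_fst _ _)).
  apply: (computable_comp computable_string_enum).
  apply: (@computable_search (fun k n => (hi ((string_enum n).1, k + 3) <= 4)%N)).
  - apply: computable_leq; last exact: computable_const.
    apply: (computable_comp hhi); apply: computable_pair.
      apply: (computable_comp (@computable_fst _ _)).
      exact: (computable_comp computable_string_enum (@computable_snd _ _)).
    by apply: computable_addn; [exact: computable_fst|exact: computable_const].
  - by move=> k; case: ex_minnP.
  - by move=> k n; case: ex_minnP => m _; exact.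
move=> k; rewrite /t; case: ex_minnP => n hn _.
have [_ h _] := H (string_enum n).1 (k + 3)%N.
move: hn; rewrite -(ler_nat R) => /(le_trans h).
have k0 : (0 : R) < 2 ^+ k by rewrite exprn_gt0.
rewrite exprD (_ : 2 ^+ 3 = 8 :> R); last by ring.
move=> h8; rewrite exprS -(ler_pM2l (x := 2 * 2 ^+ k)) ?mulr_gt0 // divff; last first.
  by rewrite mulf_neq0 ?gt_eqF.
by lra.
Qed.

(* An empty c.e. open set is not enumerated by a sequence of strings, so each
   member of the test is enlarged by a cylinder of small measure. *)
Lemma MLR_avoids nu (T : nat * seq bool * nat -> bool) w :
  computable_measure nu -> computable_fun T ->
  (forall k, (nu (\bigcup_(s in [set s | exists j, T (k, s, j)]) cylinder s)
              <= (2 ^- k.+1)%:E)%E) ->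
  MLR nu w -> exists k, forall n j, ~~ T (k, mkseq w n, j).
Proof.
move=> hnu hT small wMLR; have [t ht tE] := computable_small_string hnu.
(* The second index runs through all pairs of a string and a stage; a pair at which the test does
   not fire is sent to the small cylinder. *)
pose u (p : nat * nat) := if T (p.1, (string_enum p.2).1, (string_enum p.2).2)
  then (string_enum p.2).1 else t p.1.
apply: contrapT => nex; apply: (wMLR (fun n => \bigcup_k cylinder (u (n, k)))).
- exists u => //.
  have he := computable_comp computable_string_enum (@computable_snd nat nat).
  have he1 := computable_comp (@computable_fst _ _) he.
  have he2 := computable_comp (@computable_snd _ _) he.
  apply: computable_if => //.
    apply: (computable_comp hT); do 2 apply: computable_pair => //.
    exact: computable_fst.
  exact: (computable_comp ht (@computable_fst _ _)).
- move=> k; set W := \bigcup_(s in [set s | exists j, T (k, s, j)]) cylinder s.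
  have mW : measurable (W : set cantor_borel) := measurable_bigcup_cylinder _.
  have mt : measurable (cylinder (t k) : set cantor_borel) := measurable_cylinder _.
  apply: (@le_trans _ _ (nu (W `|` cylinder (t k)))).
    apply: le_measure; rewrite ?inE //.
    + rewrite (_ : \bigcup_i _ = \bigcup_(s in range (fun i => u (k, i))) cylinder s).
        exact: measurable_bigcup_cylinder.
      by rewrite bigcup_image.
    + exact: measurableU.
    + move=> v [i _]; rewrite /u /=; case: ifP => [Ti vi|_ vt]; last by right.
      by left; exists (string_enum i).1 => //; exists (string_enum i).2.
  apply: le_trans (measureU2 nu mW mt) _.
  apply: le_trans (leeD (small k) (_ : nu (cylinder (t k)) <= (2 ^- k.+1)%:E)%E) _.
    by rewrite weightE lee_fin.
  rewrite -EFinD lee_fin exprS.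
  by have : (0 : R) < 2 ^+ k by [rewrite exprn_gt0]; move=> k0; rewrite invfM; lra.
- move=> k _; apply: contrapT => nu'; apply: nex; exists k => n j; apply/negP => Tnj.
  have [i iE] := string_enum_surj (mkseq w n) j.
  apply: nu'; exists i => //; rewrite /u iE ifT //; exact: cylinder_mkseq.
Qed.

End randomness_tests.

Local Open Scope charge_scope.

(** * The Hellinger step *)

Lemma measurable_sub_cylinder s :
  measurable (cylinder s : set (cantor_sub (size s))).
Proof. by apply: sub_sigma_algebra; exists s. Qed.

(** The sets that do not separate [v] from [w] form a sigma-algebra containing the generating
    cylinders. *)
Lemma measurable_sub_saturated n (A : set (cantor_sub n)) (v w : cantor_space) :
  measurable A -> mkseq v n = mkseq w n -> A v -> A w.
Proof.
move=> mA vw.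
suff : measurable `<=` [set B : set (cantor_sub n) | B v <-> B w].
  by move=> /(_ _ mA) /= <-.
apply: smallest_sub => [|_ [s sn <-]]; last first.
  by rewrite /cylinder /= sn vw.
split=> [//|B /= BE|B /= BE].
- by rewrite /setD /= BE.
- by split=> -[k _ Bk]; exists k => //; apply/BE.
Qed.

Lemma sub_measurable_fun_cst n d (T : measurableType d) (f : cantor_sub n -> T)
    (v w : cantor_space) :
  measurable [set f v] -> measurable_fun setT f -> mkseq v n = mkseq w n -> f w = f v.
Proof.
move=> m1 mf vw; have := mf measurableT _ m1; rewrite setTI => mfv.
exact: (measurable_sub_saturated mfv vw).
Qed.

Section hellinger_on_cylinders.
Variable R : realType.

(** The derivative is measurable for [cantor_sub n], hence constant on a cylinder of length [n]; its
    integral [p] there is that constant times [q]. Its value is thus known at every point of the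
    cylinder, and not merely almost everywhere. *)
Lemma Radon_Nikodym_cylinder (n : nat) (P Q : probability (cantor_sub n) R) s (p q : R) :
  charge_of_finite_measure P `<< Q -> size s = n ->
  P (cylinder s) = p%:E -> Q (cylinder s) = q%:E -> 0 < q ->
  forall v, cylinder s v -> ('d (charge_of_finite_measure P) '/d Q) v = (p / q)%:E.
Proof.
move=> PQ sn Ps Qs q0 v sv; set f := 'd _ '/d Q.
have ms : measurable (cylinder s : set (cantor_sub n)).
  by move: (@measurable_sub_cylinder s); rewrite sn.
have mf : measurable_fun setT f.
  by have /integrableP[] := Radon_Nikodym_integrable PQ.
have : charge_of_finite_measure P (cylinder s) = (\int[Q]_(x in cylinder s) f x)%E.
  exact: Radon_Nikodym_integral.
rewrite [LHS]Ps (eq_integral (cst (f v))); last first.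
  move=> x; rewrite inE => sx; apply: sub_measurable_fun_cst mf _.
    exact: emeasurable_set1.
  by rewrite -sn -(cylinder_eq sv) -(cylinder_eq sx).
rewrite integral_cst //= [X in (_ * X)%E]Qs.
have : f v \is a fin_num by apply: Radon_Nikodym_fin_num.
move=> /fineK <-; rewrite -EFinM => -[->]; rewrite mulfK //.
by rewrite gt_eqF.
Qed.

(** With all of the mass of [Q] on two atoms, the expectation is a sum of two terms
    [q * sqrt (p / q)], each equal to [sqrt (p * q)]. *)
Lemma hellinger_two_cylinders (n : nat) (P Q : probability (cantor_sub n) R) a b
    (pa pb qa qb : R) :
  charge_of_finite_measure P `<< Q -> size a = n -> size b = n -> a != b ->
  P (cylinder a) = pa%:E -> P (cylinder b) = pb%:E ->
  Q (cylinder a) = qa%:E -> Q (cylinder b) = qb%:E ->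
  0 <= pa -> 0 <= pb -> 0 < qa -> 0 < qb ->
  Q (~` (cylinder a `|` cylinder b)) = 0%E ->
  hellinger P Q = Num.sqrt (2 * (1 - (Num.sqrt (pa * qa) + Num.sqrt (pb * qb)))).
Proof.
move=> PQ an bn ab Pa Pb Qa Qb pa0 pb0 qa0 qb0 Q0.
rewrite /hellinger unlock; set f := 'd _ '/d Q.
congr (Num.sqrt (_ * (_ - _))).
have mf : measurable_fun setT f.
  by have /integrableP[] := Radon_Nikodym_integrable PQ.
have ma : measurable (cylinder a : set (cantor_sub n)).
  by move: (@measurable_sub_cylinder a); rewrite an.
have mb : measurable (cylinder b : set (cantor_sub n)).
  by move: (@measurable_sub_cylinder b); rewrite bn.
pose g := fun w => (Num.sqrt (fine (f w)))%:E : \bar R.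
have mg : measurable_fun setT g.
  apply/measurable_EFinP.
  apply: (@measurableT_comp _ _ _ _ _ _ (@Num.sqrt R) _ (fine \o f)).
    by apply: continuous_measurable_fun; exact: sqrt_continuous.
  by apply: measurableT_comp => //; exact: fine_measurable.
have g0 x : (0 <= g x)%E by rewrite lee_fin sqrtr_ge0.
have E : forall s p q, size s = n -> P (cylinder s) = p%:E ->
    Q (cylinder s) = q%:E -> 0 <= p -> 0 < q ->
    (\int[Q]_(x in cylinder s) g x)%E = (Num.sqrt (p * q))%:E.
  move=> s p q sn Ps Qs p0 q0.
  have ms : measurable (cylinder s : set (cantor_sub n)).
    by move: (@measurable_sub_cylinder s); rewrite sn.
  rewrite (eq_integral (cst (Num.sqrt (p / q))%:E)).
    rewrite integral_cst //= [X in (_ * X)%E]Qs -EFinM; congr EFin.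
    rewrite -{2}(sqr_sqrtr (ltW q0)) expr2 mulrA -sqrtrM ?(divr_ge0 p0 (ltW q0)) //.
    by rewrite divfK ?gt_eqF // -sqrtrM.
  move=> x; rewrite inE /g => sx; congr (Num.sqrt _)%:E.
  by rewrite /f (Radon_Nikodym_cylinder PQ sn Ps Qs).
have -> : (\int[Q]_w (Num.sqrt (fine (f w)))%:E)%E = (\int[Q]_(x in setT) g x)%E by [].
rewrite (_ : [set: cantor_sub n] =
    (cylinder a `|` cylinder b) `|` ~` (cylinder a `|` cylinder b)).
  rewrite ge0_integral_setU //; last 4 first.
  - exact: measurableU.
  - by apply: measurableC; exact: measurableU.
  - exact: measurable_funTS.
  - by rewrite disj_set2E setICr.
  rewrite [X in (_ + X)%E]null_set_integral // ?adde0; last 2 first.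
  - by apply: measurableC; exact: measurableU.
  - exact: measurable_funTS.
  rewrite ge0_integral_setU //; last 2 first.
  - exact: measurable_funTS.
  - rewrite disj_set2E; apply/eqP/seteqP; split=> // x [ax bx].
    by move: ab; rewrite (cylinder_eq ax) (cylinder_eq bx) an bn eqxx.
  by rewrite (E a pa qa) // (E b pb qb) // -EFinD.
by rewrite setUv.
Qed.

End hellinger_on_cylinders.

(** [Num.sqrt] is 0 on negative numbers, so an upper bound on the radicand of the Hellinger distance
    carries over whatever its sign. *)
Lemma sqr_sqrt_le (R : rcfType) (x y : R) : x <= y -> 0 <= y -> Num.sqrt x ^+ 2 <= y.
Proof.
move=> xy y0; have [x0|x0] := leP 0 x; first by rewrite sqr_sqrtr.
by rewrite ler0_sqrtr ?expr0n // ltW.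
Qed.

(** With a and b the square roots, the left side is (a - b)^2, and (a^2 - b^2)^2 = (a - b)^2 (a +
    b)^2 with (a + b)^2 >= a^2 + b^2. This is where the square roots leave the argument. *)
Lemma sqr_sqrtB_le (R : rcfType) (p q : R) : 0 < p -> 0 < q ->
  p + q - 2 * Num.sqrt (p * q) <= (p - q) ^+ 2 / (p + q).
Proof.
move=> p0 q0; have pq0 : 0 < p + q by rewrite addr_gt0.
rewrite ler_pdivlMr // sqrtrM ?(ltW p0) //.
have hp := sqr_sqrtr (ltW p0); have hq := sqr_sqrtr (ltW q0).
have := sqrtr_ge0 p; have := sqrtr_ge0 q.
move: hp hq; set a := Num.sqrt p; set b := Num.sqrt q => <- <- b0 a0.
have -> : (a ^+ 2 - b ^+ 2) ^+ 2 =
    (a ^+ 2 + b ^+ 2 - 2 * (a * b)) * (a ^+ 2 + b ^+ 2 + 2 * (a * b)) by ring.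
apply: ler_wpM2l; last by rewrite lerDl !mulr_ge0.
by rewrite (_ : _ - _ = (a - b) ^+ 2) ?sqr_ge0 //; ring.
Qed.

(** * Rational upper bound for the squared Hellinger step *)

Section increments.
Variable R : realType.
Implicit Types nu mu : probability cantor_borel R.

(* Conditional nu-expectation at s of the increment of nu / (nu + mu), cleared of
   nested fractions. *)
Definition increment nu mu (s : seq bool) : R :=
  let n := weight nu s in let m := weight mu s in
  let n0 := weight nu (rcons s false) in let n1 := weight nu (rcons s true) in
  let m0 := weight mu (rcons s false) in let m1 := weight mu (rcons s true) in
  (n0 * m1 - m0 * n1) ^+ 2 / (n * (n + m) * (n0 + m0) * (n1 + m1)).

Lemma increment_ge0 nu mu s : 0 <= increment nu mu s.
Proof.
by rewrite /increment divr_ge0 ?sqr_ge0 // !mulr_ge0 ?addr_ge0 ?weight_ge0.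
Qed.

(** The probabilities sum to one, so the left side splits into two terms (sqrt p - sqrt q)^2, and
    [sqr_sqrtB_le] makes each rational. What remains is to compare two denominators under the ratio
    bounds. *)
Lemma two_point_hellinger_le (n0 n1 m0 m1 c : R) (n := n0 + n1) (m := m0 + m1) :
  0 < n0 -> 0 < n1 -> 0 < m0 -> 0 < m1 -> 1 <= c -> n <= c * m -> m <= c * n ->
  2 * (1 - (Num.sqrt (n0 / n * (m0 / m)) + Num.sqrt (n1 / n * (m1 / m))))
  <= 4 * c ^+ 3 * ((n0 * m1 - m0 * n1) ^+ 2 / (n * (n + m) * (n0 + m0) * (n1 + m1))).
Proof.
move=> n00 n10 m00 m10 c1 nm mn.
have n_gt0 : 0 < n by rewrite addr_gt0.
have m_gt0 : 0 < m by rewrite addr_gt0.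
have c0 : 0 < c by lra.
have := sqr_sqrtB_le (divr_gt0 n00 n_gt0) (divr_gt0 m00 m_gt0).
have := sqr_sqrtB_le (divr_gt0 n10 n_gt0) (divr_gt0 m10 m_gt0).
set r0 := Num.sqrt (n0 / n * _); set r1 := Num.sqrt (n1 / n * _) => h1 h0.
have -> : 2 * (1 - (r0 + r1)) =
    (n0 / n + m0 / m - 2 * r0) + (n1 / n + m1 / m - 2 * r1).
  by rewrite /n /m; field; rewrite !gt_eqF.
apply: le_trans (lerD h0 h1) _.
have A0 : 0 < n0 * m + m0 * n by rewrite addr_gt0 ?mulr_gt0.
have B0 : 0 < n1 * m + m1 * n by rewrite addr_gt0 ?mulr_gt0.
(* Up to sign both differences are (n0 m1 - m0 n1) / (n m), and the two factors of the new
   denominator add up to 2 n m, whence the leading 2. *)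
have -> : (n0 / n - m0 / m) ^+ 2 / (n0 / n + m0 / m) +
    (n1 / n - m1 / m) ^+ 2 / (n1 / n + m1 / m) =
    2 * (n0 * m1 - m0 * n1) ^+ 2 / ((n0 * m + m0 * n) * (n1 * m + m1 * n)).
  rewrite /n /m; field.
  by rewrite !gt_eqF //; rewrite -/n -/m ?addr_gt0 // ?mulr_gt0 // ?divr_gt0.
set A := n0 * m + m0 * n in A0 *; set B := n1 * m + m1 * n in B0 *.
set D := n * (n + m) * (n0 + m0) * (n1 + m1); set E := (_ - _) ^+ 2.
have D0 : 0 < D by rewrite !mulr_gt0 ?addr_gt0.
have E0 : 0 <= E by exact: sqr_ge0.
have cA : n * (n0 + m0) <= c * A.
  have := ler_wpM2r (ltW n00) nm; have : m0 * n <= c * (m0 * n).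
    by rewrite ler_peMl // ?mulr_ge0 ?ltW.
  by rewrite /A; lra.
have cB : n * (n1 + m1) <= c * B.
  have := ler_wpM2r (ltW n10) nm; have : m1 * n <= c * (m1 * n).
    by rewrite ler_peMl // ?mulr_ge0 ?ltW.
  by rewrite /B; lra.
(* One factor [c] comes from each of [cA] and [cB], and a factor [2 * c] from [n + m <= 2 * c * n];
   the leading 2 above then turns [2 * c ^+ 3] into [4 * c ^+ 3]. *)
have key : D <= 2 * c ^+ 3 * (A * B).
  have h : n * (n0 + m0) * (n * (n1 + m1)) <= c * A * (c * B).
    by apply: ler_pM => //; rewrite mulr_ge0 ?addr_ge0 ?ltW.
  have h' : n + m <= 2 * c * n.
    have : n <= c * n by rewrite ler_peMl // ltW.
    by lra.
  rewrite -(ler_pM2l n_gt0).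
  have -> : n * D = (n + m) * (n * (n0 + m0) * (n * (n1 + m1))) by rewrite /D; ring.
  have -> : n * (2 * c ^+ 3 * (A * B)) = 2 * c * n * (c * A * (c * B)) by ring.
  by apply: ler_pM => //; rewrite ?mulr_ge0 ?addr_ge0 ?ltW // ?mulr_gt0 ?addr_gt0.
rewrite ler_pdivrMr ?mulr_gt0 //.
have -> : 4 * c ^+ 3 * (E / D) * (A * B) = 2 * (E / D) * (2 * c ^+ 3 * (A * B)) by ring.
rewrite (_ : 2 * E = 2 * (E / D) * D); last by field; rewrite gt_eqF.
by apply: ler_wpM2l key; rewrite mulr_ge0 // divr_ge0 // ltW.
Qed.

Lemma conditionalE nu s A : full_support nu ->
  conditional nu s A = (nu (A `&` cylinder s) * (weight nu s)^-1%:E)%E.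
Proof.
move=> nu_full; have E : mrestr nu (measurable_cylinder s) setT = (weight nu s)%:E.
  by rewrite /mrestr setTI weightE.
by rewrite /conditional /mnormalize /= E eqe gt_eqF ?weight_gt0.
Qed.

Lemma restriction_conditional_cylinder nu s b : full_support nu ->
  restriction (size s).+1 (conditional nu s) (cylinder (rcons s b))
  = (weight nu (rcons s b) / weight nu s)%:E.
Proof.
move=> nu_full.
have -> : restriction (size s).+1 (conditional nu s) (cylinder (rcons s b)) =
  conditional nu s (cylinder (rcons s b)) by [].
rewrite conditionalE // setIidl ?weightE //.
by move=> w /cylinder_rcons[].
Qed.

(** A set of the sub-sigma-algebra that meets [cylinder s] contains, within [cylinder s], a full
    cylinder of positive measure, so a null set misses [cylinder s] altogether. This makes the
    derivative inside [hellinger] meaningful. *)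
Lemma restriction_conditional_dominates nu mu s n :
  full_support nu -> full_support mu ->
  charge_of_finite_measure (restriction n (conditional nu s)) `<<
  restriction n (conditional mu s).
Proof.
move=> nu_full mu_full; apply/null_content_dominatesP => A mA.
have mA' : measurable (A : set cantor_borel).
  by rewrite -[A]setTI; exact: (@measurable_to_sub n measurableT _ mA).
change (conditional mu s A = 0%E -> conditional nu s A = 0%E).
rewrite !conditionalE //.
case: (pselect (A `&` cylinder s = set0)) => [->|]; first by rewrite !measure0 !mul0e.
move=> /eqP/set0P[w [Aw sw]] H; exfalso; move: H.
suff : (0 < mu (A `&` cylinder s))%E.
  move=> gt0 /eqP; rewrite mule_eq0 => /orP[/eqP E|]; first by rewrite E ltxx in gt0.
  by rewrite eqe invr_eq0 gt_eqF // weight_gt0.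
(* Depth at least [n] keeps the cylinder inside [A]; depth at least [size s] keeps it inside
   [cylinder s]. *)
apply: lt_le_trans (mu_full (mkseq w (maxn n (size s)))) _.
apply: le_measure; rewrite ?inE.
- exact: measurable_cylinder.
- by apply: measurableI => //; exact: measurable_cylinder.
have takeE (v : cantor_space) k : (k <= maxn n (size s))%N ->
    mkseq v k = take k (mkseq v (maxn n (size s))).
  by move=> le; rewrite /mkseq -map_take take_iota (minn_idPl le).
move=> v; rewrite /cylinder /= size_mkseq => vw; split.
  apply: (measurable_sub_saturated mA _ Aw).
  by rewrite (takeE w) ?leq_maxl // -vw -takeE ?leq_maxl.
by rewrite (takeE v) ?leq_maxr // vw -takeE ?leq_maxr.
Qed.

Lemma hellinger_stepE nu mu n w (s := mkseq w n) : full_support nu -> full_support mu ->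
  hellinger_step nu mu n w = Num.sqrt (2 * (1 -
   (Num.sqrt (weight nu (rcons s false) / weight nu s *
              (weight mu (rcons s false) / weight mu s)) +
    Num.sqrt (weight nu (rcons s true) / weight nu s *
              (weight mu (rcons s true) / weight mu s))))).
Proof.
move=> nu_full mu_full; rewrite /hellinger_step -/s.
have sn : size s = n by rewrite size_mkseq.
rewrite -sn.
apply: (@hellinger_two_cylinders R (size s).+1 _ _ (rcons s false) (rcons s true)).
- exact: restriction_conditional_dominates.
- by rewrite size_rcons.
- by rewrite size_rcons.
- by rewrite eqseq_rcons andbF.
- exact: restriction_conditional_cylinder.
- exact: restriction_conditional_cylinder.
- exact: restriction_conditional_cylinder.
- exact: restriction_conditional_cylinder.
- by rewrite divr_ge0 ?weight_ge0.
- by rewrite divr_ge0 ?weight_ge0.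
- by rewrite divr_gt0 ?weight_gt0.
- by rewrite divr_gt0 ?weight_gt0.
- set A := ~` _.
  change (conditional mu s A = 0%E).
  rewrite conditionalE // (_ : _ `&` _ = set0) ?measure0 ?mul0e //.
  apply/seteqP; split=> // v [nv sv]; apply: nv.
  by case E : (v (size s)); [right|left]; apply/cylinder_rcons.
Qed.

Lemma hellinger_step_le nu mu n w (c : R) : full_support nu -> full_support mu ->
  1 <= c -> weight nu (mkseq w n) <= c * weight mu (mkseq w n) ->
  weight mu (mkseq w n) <= c * weight nu (mkseq w n) ->
  hellinger_step nu mu n w ^+ 2 <= 4 * c ^+ 3 * increment nu mu (mkseq w n).
Proof.
move=> nu_full mu_full c1 h1 h2; rewrite hellinger_stepE //.
have c0 : 0 <= c by lra.
apply: sqr_sqrt_le; last first.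
  by apply: mulr_ge0; [apply: mulr_ge0 => //; exact: exprn_ge0|exact: increment_ge0].
move: h1 h2; rewrite /increment !(weight_rcons _ (mkseq w n)) => h1 h2.
by apply: two_point_hellinger_le; rewrite ?weight_gt0.
Qed.

End increments.

(** * Boundedness of the likelihood ratios *)

(** Passes from integer inequalities, valid at every scale with a fixed error, to an exact
    inequality between measures. *)
Lemma le0_geometric (R : realType) (x C : R) : (forall j, 2 ^+ j * x <= C) -> x <= 0.
Proof.
move=> H; rewrite leNgt; apply/negP => x0.
pose j := (Num.truncn (C / x)).+1.
have h1 : C / x < j%:R by rewrite truncnS_gt.
have h2 : j%:R < 2 ^+ j :> R by rewrite -natrX ltr_nat ltn_expl.
have := H j; rewrite leNgt => /negP; apply.
by rewrite -ltr_pdivrMr // (lt_trans h1).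
Qed.

Section tests.
Variable R : realType.
Implicit Types nu mu : probability cantor_borel R.

(** [T] compares the upper bracket of [nu] with the lower bracket of [mu], so firing is conclusive.
    If it never fires, the reverse inequality holds up to bracket widths, which are negligible as
    the scale grows. *)
Lemma ratio_test nu mu (C : nat -> nat) :
  computable_measure nu -> computable_measure mu -> computable_fun C ->
  exists T : nat * seq bool * nat -> bool, [/\ computable_fun T,
    forall k s j, T (k, s, j) -> (C k)%:R * weight nu s <= weight mu s &
    forall k s, (forall j, ~~ T (k, s, j)) -> weight mu s <= (C k)%:R * weight nu s].
Proof.
move=> /nat_bounds[nl [nh [_ hnh N]]] /nat_bounds[ml [mh [hml _ M]]] hC.
have pow2_gt0 j : (0 : R) < 2 ^+ j by rewrite exprn_gt0.
exists (fun p => (C p.1.1 * nh (p.1.2, p.2) < ml (p.1.2, p.2))%N); split.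
- have c11 := computable_comp (@computable_fst nat (seq bool)) (@computable_fst _ nat).
  have carg : computable_fun (fun p : nat * seq bool * nat => (p.1.2, p.2)).
    apply: computable_pair; last exact: computable_snd.
    exact: (computable_comp (@computable_snd _ _) (@computable_fst _ _)).
  apply: computable_leq; last exact: (computable_comp hml carg).
  apply: computable_succ; apply: computable_muln; last exact: (computable_comp hnh carg).
  exact: (computable_comp hC c11).
- move=> k s j /= T; have [_ nj _] := N s j; have [mj _ _] := M s j.
  rewrite -(ler_pM2l (pow2_gt0 j)); apply: le_trans mj; rewrite mulrCA.
  apply: (@le_trans _ _ ((C k)%:R * (nh (s, j))%:R)); first exact: ler_wpM2l.
  by rewrite -natrM ler_nat ltnW.
- move=> k s nT; rewrite -subr_le0.
  (* Each bracket has width at most 3, and that of [nu] is multiplied by [C k]. *)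
  apply: (@le0_geometric _ _ ((C k * 3 + 3)%:R)) => j.
  have [nj _ hj] := N s j; have [_ mj hj'] := M s j.
  have : (mh (s, j) <= C k * nl (s, j) + (C k * 3 + 3))%N.
    rewrite addnA -mulnDr (leq_trans hj') // leq_add2r.
    by move: (nT j); rewrite /= -leqNgt => /leq_trans; apply; rewrite leq_mul2l hj orbT.
  rewrite -(ler_nat R) natrD natrM => h.
  have := ler_wpM2l (ler0n R (C k)) nj; lra.
Qed.

Lemma bounded_ratio_nu nu mu w : computable_measure nu -> computable_measure mu ->
  MLR nu w -> exists C : nat, forall n,
    weight mu (mkseq w n) <= C%:R * weight nu (mkseq w n).
Proof.
move=> hnu hmu wR.
have hC : computable_fun (fun k => 2 ^ k.+1)%N.
  apply: computable_expn; first exact: computable_const.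
  by apply: computable_succ; exact: computable_id.
have [T [hT T1 T2]] := ratio_test hnu hmu hC.
have [k H] : exists k, forall n j, ~~ T (k, mkseq w n, j).
  apply: MLR_avoids hT _ wR => // k.
  set U := bigcup _ _.
  have mU : measurable (U : set cantor_borel) := measurable_bigcup_cylinder _.
  have := @ville R nu (weight mu) [set s | exists j, T (k, s, j)] (2 ^+ k.+1).
  rewrite weight_nil -/U -[nu U]fineK ?fin_num_measure // -EFinM !lee_fin => V.
  rewrite -(ler_pM2l (x := 2 ^+ k.+1)) ?exprn_gt0 // divff ?gt_eqF ?exprn_gt0 //.
  apply: V => //.
  - exact: weight_ge0.
  - by move=> s; rewrite -weight_rcons.
  - by move=> s [j /T1]; rewrite natrX.
by exists (2 ^ k.+1)%N => n; apply: T2 => j; exact: H.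
Qed.

(** Rationals are coded by their reduced fractions, so the computability of the sequence of
    tolerances rests on this explicit form. *)
Lemma valq_pow2V n : valq (2 ^- n) = (1, (2 ^ n)%N%:Z).
Proof.
have E : (2 ^- n : rat) = 1%:~R / (2 ^ n)%N%:Z%:~R by rewrite div1r -pmulrn natrX.
rewrite [LHS]surjective_pairing -/(numq _) -/(denq _) E.
rewrite coprimeq_num ?coprimeq_den ?coprime1n //.
rewrite gtr0_sg ?mulr1; last by rewrite ltz_nat expn_gt0.
by case: ifP => // /eqP [] /eqP; rewrite expn_eq0.
Qed.

Lemma bounded_ratio_mu nu mu w : computable_measure nu -> computable_measure mu ->
  dominates_comp nu mu -> MLR nu w -> exists C : nat, forall n,
    weight nu (mkseq w n) <= C%:R * weight mu (mkseq w n).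
Proof.
move=> hnu hmu [m hm mP] wR.
have e0 k : 0 < (2 ^- k.+1 : rat) by rewrite invr_gt0 exprn_gt0.
pose e k : posrat := exist _ (2 ^- k.+1) (e0 k).
have he : computable_fun e.
  apply: (@computable_pickle _ _ _ (fun k => (1%:Z, (2 ^ k.+1)%N%:Z))) => [k|].
    by rewrite -valq_pow2V.
  apply: computable_pair; first exact: computable_const.
  apply: (computable_comp computable_Posz).
  apply: computable_expn; first exact: computable_const.
  by apply: computable_succ; exact: computable_id.
(* With [m (e k) = p / d] and p >= 1, the value d + 1 gives 1 / (d + 1) < p / d. Ville's inequality
   for [mu] then puts the test below the threshold at which domination yields [nu]-measure less than
   [2 ^- k.+1]. *)
pose C k := (int_nat (denq (val (m (e k))))).+1.
have hC : computable_fun C.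
  apply: computable_succ; apply: (computable_comp computable_int_nat).
  apply: (computable_comp (@computable_snd _ _)).
  apply: (computable_comp computable_valq).
  have hv : computable_fun (fun p : posrat => val p).
    by apply: computable_pickle (@computable_id _).
  exact: (computable_comp hv (computable_comp hm he)).
have C0 k : (0 : R) < (C k)%:R by rewrite ltr0n.
have CE k : (C k)%:R^-1 < ratr (val (m (e k))) :> R.
  rewrite -(ratr_nat R (C k)) -fmorphV ltr_rat /C.
  case: (m (e k)) => q /= q0; rewrite -[q in ltRHS]divq_num_den.
  have : 0 < numq q by rewrite numq_gt0.
  case: (denq q) (denq_gt0 q) => [d d0|//]; case: (numq q) => [p p0|//] /=.
  rewrite -pmulrn ltr_pdivlMr ?ltr0n // mulrC ltr_pdivrMr ?ltr0n //.
  rewrite -pmulrn -natrM ltr_nat; have {}p0 : (0 < p)%N := p0.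
  by nia.
have [T [hT T1 T2]] := ratio_test hmu hnu hC.
have [k H] : exists k, forall n j, ~~ T (k, mkseq w n, j).
  apply: MLR_avoids hT _ wR => // k.
  set U := bigcup _ _.
  have mU : measurable (U : set cantor_borel) := measurable_bigcup_cylinder _.
  have := @ville R mu (weight nu) [set s | exists j, T (k, s, j)] (C k)%:R.
  rewrite weight_nil -/U => V.
  apply: ltW; have -> : 2 ^- k.+1 = ratr (val (e k)) :> R.
    by rewrite /= fmorphV rmorphXn /= ratr_nat.
  apply: mP => //; apply: le_lt_trans (_ : (C k)%:R^-1%:E < _)%E; last by rewrite lte_fin.
  rewrite -[mu U]fineK ?fin_num_measure // lee_fin.
  move: V; rewrite -[mu U]fineK ?fin_num_measure // -EFinM !lee_fin => V.
  rewrite -(ler_pM2l (C0 k)) divff ?gt_eqF //.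
  apply: V => //.
  - exact: weight_ge0.
  - by move=> s; rewrite -weight_rcons.
  - by move=> s [j /T1].
by exists (C k) => n; apply: T2 => j; exact: H.
Qed.

End tests.

(** * Boundedness of the sum of the increments *)

Section increment_test.
Variable R : realType.
Implicit Types nu mu : probability cantor_borel R.

Definition scale (j : nat) : R := 2 ^- j.

Lemma cvg_scale : scale @ \oo --> (0 : R).
Proof.
have := @cvg_expr R (2^-1).
rewrite ger0_norm ?invr_ge0 // invf_lt1 // ltr1n => /(_ isT).
by under eq_cvg do rewrite exprVn.
Qed.

Lemma cvg_bound (u : nat -> nat) (x a b : R) :
  (forall j, 2 ^+ j * x - a <= (u j)%:R) -> (forall j, (u j)%:R <= 2 ^+ j * x + b) ->
  (fun j => scale j * (u j)%:R) @ \oo --> x.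
Proof.
move=> la lb.
have E y j : scale j * (2 ^+ j * x + y) = x + scale j * y.
  by rewrite mulrDr mulrA mulVf ?mul1r // expf_neq0.
have cv y : (fun j => x + scale j * y) @ \oo --> x.
  rewrite -[X in _ --> X]addr0 -(mul0r y); apply: cvgD; first exact: cvg_cst.
  by apply: cvgMl; exact: cvg_scale.
apply: (squeeze_cvgr _ (cv (- a)) (cv b)); apply: nearW => j.
by rewrite -!E !ler_wpM2l // ?invr_ge0 ?exprn_ge0 // -/(scale j).
Qed.

(** * Integer lower approximations of the increments *)

Section approximation.
Variables (nl nh ml mh : seq bool * nat -> nat).

(* A lower bound for the scaled |n0 m1 - m0 n1|: at most one of the two truncated
   differences is nonzero. *)
Definition gap_approx s j : nat :=
  ((nl (rcons s false, j) * ml (rcons s true, j) -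
    mh (rcons s false, j) * nh (rcons s true, j))
  + (ml (rcons s false, j) * nl (rcons s true, j) -
    nh (rcons s false, j) * mh (rcons s true, j)))%N.

Definition den_approx s j : nat :=
  (nh (s, j) * (nh (s, j) + mh (s, j)) * (nh (rcons s false, j) + mh (rcons s false, j))
   * (nh (rcons s true, j) + mh (rcons s true, j)))%N.

(** The squared gap and the denominator both have degree 4 in the measures, so their scales cancel
    and the factor [2 ^ j] is the scale of the result. Lower brackets above and upper brackets
    below, with rounding down, make it a lower bound. *)
Definition increment_approx s j : nat :=
  ((2 ^ j * gap_approx s j ^ 2) %/ den_approx s j)%N.

Hypotheses (hnl : computable_fun nl) (hnh : computable_fun nh)
  (hml : computable_fun ml) (hmh : computable_fun mh).

Lemma computable_increment_approx :
  computable_fun (fun p : nat * seq bool => increment_approx p.2 p.1).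
Proof.
have c1 := @computable_fst nat (seq bool); have c2 := @computable_snd nat (seq bool).
have cs f : computable_fun f ->
    computable_fun (fun p : nat * seq bool => f (p.2, p.1) : nat).
  by move=> hf; apply: (computable_comp hf); exact: computable_pair.
have cr f b : computable_fun f ->
    computable_fun (fun p : nat * seq bool => f (rcons p.2 b, p.1) : nat).
  move=> hf; apply: (computable_comp hf); apply: computable_pair => //.
  by apply: computable_rcons => //; exact: computable_const.
apply: computable_divn.
  apply: computable_muln.
    by apply: computable_expn => //; exact: computable_const.
  apply: computable_expn; last exact: computable_const.
  by apply: computable_addn; apply: computable_subn; apply: computable_muln;
    apply: cr.
rewrite /den_approx; apply: computable_muln; last by apply: computable_addn; apply: cr.
apply: computable_muln; last by apply: computable_addn; apply: cr.
apply: computable_muln; last apply: computable_addn; exact: cs.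
Qed.

Variables nu mu : probability cantor_borel R.
Hypotheses (nu_full : full_support nu) (mu_full : full_support mu).
Hypotheses (nE : brackets nu nl nh) (mE : brackets mu ml mh).

Lemma increment_approx_le s j :
  (increment_approx s j)%:R <= 2 ^+ j * increment nu mu s.
Proof.
have [nj1 nj2 _] := nE s j; have [mj1 mj2 _] := mE s j.
have [a1 a2 _] := nE (rcons s false) j; have [b1 b2 _] := nE (rcons s true) j.
have [c1 c2 _] := mE (rcons s false) j; have [d1 d2 _] := mE (rcons s true) j.
have pow0 : 0 < 2 ^+ j :> R by rewrite exprn_gt0.
have pos := weight_gt0 nu_full; have pos' := weight_gt0 mu_full.
rewrite /increment.
set n := weight nu s in nj1 nj2 *; set m := weight mu s in mj1 mj2 *.
set n0 := weight nu _ in a1 a2 *; set n1 := weight nu _ in b1 b2 *.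
set m0 := weight mu _ in c1 c2 *; set m1 := weight mu _ in d1 d2 *.
have n_gt0 : 0 < n by exact: pos. have m_gt0 : 0 < m by exact: pos'.
have n0_gt0 : 0 < n0 by exact: pos. have n1_gt0 : 0 < n1 by exact: pos.
have m0_gt0 : 0 < m0 by exact: pos'. have m1_gt0 : 0 < m1 by exact: pos'.
set D := n * (n + m) * (n0 + m0) * (n1 + m1).
have D0 : 0 < D by rewrite !mulr_gt0 ?addr_gt0.
have Dj : (2 ^+ j) ^+ 4 * D <= (den_approx s j)%:R.
  rewrite (_ : _ * D = (2 ^+ j * n) * (2 ^+ j * n + 2 ^+ j * m) *
    (2 ^+ j * n0 + 2 ^+ j * m0) * (2 ^+ j * n1 + 2 ^+ j * m1)); last first.
    by rewrite /D; ring.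
  rewrite /den_approx !natrM !natrD.
  have [pow0' n_ge0 m_ge0] := And3 (ltW pow0) (ltW n_gt0) (ltW m_gt0).
  have [n0_ge0 n1_ge0 m0_ge0 m1_ge0] :=
    And4 (ltW n0_gt0) (ltW n1_gt0) (ltW m0_gt0) (ltW m1_gt0).
  apply: ler_pM; [by rewrite !(mulr_ge0, addr_ge0)
    |by rewrite !(mulr_ge0, addr_ge0)| |exact: lerD].
  apply: ler_pM; [by rewrite !(mulr_ge0, addr_ge0)
    |by rewrite !(mulr_ge0, addr_ge0)| |exact: lerD].
  by apply: ler_pM => //; [by rewrite !(mulr_ge0, addr_ge0)..|exact: lerD].
have Ej : (gap_approx s j)%:R ^+ 2 <= ((2 ^+ j) ^+ 2 * (n0 * m1 - m0 * n1)) ^+ 2.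
  (* Truncated subtraction is compared with a positive part; the positive parts of a number and of
     its opposite add up to the absolute value. *)
  have lem (a b c d : nat) (x y z t : R) : 0 < x -> 0 < y -> 0 < z -> 0 < t ->
      a%:R <= 2 ^+ j * x -> b%:R <= 2 ^+ j * y ->
      2 ^+ j * z <= c%:R -> 2 ^+ j * t <= d%:R ->
      (a * b - c * d)%:R <= Num.max 0 ((2 ^+ j) ^+ 2 * (x * y - z * t)).
    move=> x0 y0 z0 t0 ax yb cz dt; rewrite le_max.
    case: (leqP (a * b) (c * d))%N => [le|lt].
      by rewrite (eqP (_ : (a * b - c * d)%N == 0%N)) ?lexx // subn_eq0.
    apply/orP; right; rewrite (natrB _ (ltnW lt)) !natrM.
    have := ler_pM (ler0n R a) (ler0n R b) ax yb.
    have : 2 ^+ j * z * (2 ^+ j * t) <= c%:R * d%:R.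
      by apply: ler_pM => //; rewrite mulr_ge0 // ltW.
    by lra.
  suff : (gap_approx s j)%:R <= `|(2 ^+ j) ^+ 2 * (n0 * m1 - m0 * n1)|.
    by move=> h; rewrite -[leRHS]real_normK ?num_real // ler_sqr ?nnegrE.
  have := lem _ _ _ _ _ _ _ _ n0_gt0 m1_gt0 m0_gt0 n1_gt0 a1 d1 c2 b2.
  have := lem _ _ _ _ _ _ _ _ m0_gt0 n1_gt0 n0_gt0 m1_gt0 c1 b1 a2 d2.
  rewrite /gap_approx natrD.
  set E := n0 * m1 - m0 * n1.
  rewrite (_ : m0 * n1 - n0 * m1 = - E); last by rewrite /E opprB.
  rewrite mulrN; set F := _ * E.
  by rewrite !maxEle !oppr_ge0; case: (ger0P F) => F0; case: ifP => // _; lra.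
have den0 : 0 < (den_approx s j)%:R :> R.
  by apply: lt_le_trans Dj; rewrite mulr_gt0 // exprn_gt0.
apply: (@le_trans _ _ (2 ^+ j * (gap_approx s j)%:R ^+ 2 / (den_approx s j)%:R)).
  by rewrite ler_pdivlMr // -!natrX -!natrM ler_nat leq_trunc_div.
rewrite -mulrA ler_pM2l // ler_pdivrMr // -/D.
apply: le_trans Ej _.
rewrite (_ : (_ * _) ^+ 2 = (n0 * m1 - m0 * n1) ^+ 2 / D * ((2 ^+ j) ^+ 4 * D)); last first.
  by field; rewrite gt_eqF.
by apply: ler_wpM2l => //; rewrite divr_ge0 ?sqr_ge0 // ltW.
Qed.

End approximation.
End increment_test.

(** * Convergence of the approximations *)

Section increment_limit.
Variable R : realType.
Variables (nl nh ml mh : seq bool * nat -> nat).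
Variables nu mu : probability cantor_borel R.
Hypotheses (nu_full : full_support nu) (mu_full : full_support mu).
Hypotheses (nE : brackets nu nl nh) (mE : brackets mu ml mh).

Local Notation scale := (@scale R).
Local Notation gap_approx := (gap_approx nl nh ml mh).
Local Notation den_approx := (den_approx nh mh).
Local Notation increment_approx := (increment_approx nl nh ml mh).

Lemma cvg_nat_bounds (la : probability cantor_borel R) (lo hi : seq bool * nat -> nat) s :
  brackets la lo hi ->
  (fun j => scale j * (lo (s, j))%:R) @ \oo --> weight la s /\
  (fun j => scale j * (hi (s, j))%:R) @ \oo --> weight la s.
Proof.
move=> H; split.
  apply: (@cvg_bound _ (fun j => lo (s, j)) _ 3 3) => j; have [h1 h2] := H s j;
    rewrite -(ler_nat R) natrD; lra.
apply: (@cvg_bound _ (fun j => hi (s, j)) _ 3 3) => j; have [h1 h2] := H s j;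
  rewrite -(ler_nat R) natrD; lra.
Qed.

(** Writes truncated subtraction through the absolute value, so that its limit follows from
    continuity. *)
Lemma natrB_max (a b : nat) : (a - b)%:R = (a%:R - b%:R + `|a%:R - b%:R|) / 2 :> R.
Proof.
case: (leqP a b) => [ab|/ltnW ba].
  have -> : (a - b)%N = 0%N by apply/eqP; rewrite subn_eq0.
  by rewrite ler0_norm ?subr_le0 ?ler_nat // subrr mul0r.
rewrite natrB // ger0_norm ?subr_ge0 ?ler_nat //.
by field.
Qed.

Let seqM (u v : nat -> R) (a b : R) : u @ \oo --> a -> v @ \oo --> b ->
  (fun j => u j * v j) @ \oo --> a * b.
Proof. by move=> ua vb; apply: cvgM. Qed.

Let seqD (u v : nat -> R) (a b : R) : u @ \oo --> a -> v @ \oo --> b ->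
  (fun j => u j + v j) @ \oo --> a + b.
Proof. by move=> ua vb; apply: cvgD. Qed.

Let seqB (u v : nat -> R) (a b : R) : u @ \oo --> a -> v @ \oo --> b ->
  (fun j => u j - v j) @ \oo --> a - b.
Proof. by move=> ua vb; apply: cvgB. Qed.

Let seqN (u : nat -> R) (a : R) : u @ \oo --> a -> (fun j => `|u j|) @ \oo --> `|a|.
Proof. by move=> ua; apply: cvg_norm. Qed.

Let seqV (u : nat -> R) (a : R) : a != 0 -> u @ \oo --> a -> (fun j => (u j)^-1) @ \oo --> a^-1.
Proof. by move=> a0 ua; apply: cvgV. Qed.

Lemma cvg_gap_approx s :
  (fun j => scale j ^+ 2 * (gap_approx s j)%:R) @ \oo -->
  `|weight nu (rcons s false) * weight mu (rcons s true) -
    weight mu (rcons s false) * weight nu (rcons s true)|.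
Proof.
set n0 := weight nu _; set m1 := weight mu _; set m0 := weight mu _; set n1 := weight nu _.
have [a b] := cvg_nat_bounds (rcons s false) nE.
have [c d] := cvg_nat_bounds (rcons s true) nE.
have [a' b'] := cvg_nat_bounds (rcons s false) mE.
have [c' d'] := cvg_nat_bounds (rcons s true) mE.
have half : (fun _ : nat => 2^-1 : R) @ \oo --> (2^-1 : R) by exact: cvg_cst.
have X := seqB (seqM a c') (seqM b' d); have Y := seqB (seqM a' c) (seqM b d').
have := seqM (seqD (seqD X (seqN X)) (seqD Y (seqN Y))) half.
rewrite -/n0 -/n1 -/m0 -/m1 (_ : _ / 2 = `|n0 * m1 - m0 * n1|); last first.
  rewrite -[m0 * n1 - n0 * m1]opprB normrN.
  by field.
move=> H; apply: cvg_trans H; apply: near_eq_cvg; apply: nearW => j /=.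
have sj0 : 0 <= scale j by rewrite invr_ge0 exprn_ge0.
rewrite /gap_approx natrD !natrB_max !natrM.
have E x y z t : scale j * x * (scale j * y) - scale j * z * (scale j * t) =
    scale j ^+ 2 * (x * y - z * t) by ring.
rewrite !E !normrM !(ger0_norm sj0).
by field.
Qed.

Lemma cvg_increment_approx s :
  (fun j => scale j * (increment_approx s j)%:R) @ \oo --> increment nu mu s.
Proof.
have [_ a] := cvg_nat_bounds s nE; have [_ a'] := cvg_nat_bounds s mE.
have [_ b] := cvg_nat_bounds (rcons s false) nE.
have [_ c] := cvg_nat_bounds (rcons s true) nE.
have [_ b'] := cvg_nat_bounds (rcons s false) mE.
have [_ c'] := cvg_nat_bounds (rcons s true) mE.
have den := seqM (seqM (seqM a (seqD a a')) (seqD b b')) (seqD c c').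
have pos := weight_gt0 nu_full; have pos' := weight_gt0 mu_full.
have den0 : weight nu s * (weight nu s + weight mu s) *
   (weight nu (rcons s false) + weight mu (rcons s false)) *
   (weight nu (rcons s true) + weight mu (rcons s true)) != 0.
  by rewrite gt_eqF // !mulr_gt0 ?addr_gt0.
have gap := seqM (@cvg_gap_approx s) (@cvg_gap_approx s).
(* Rounding down loses less than 1, which is less than [scale j] after rescaling; this sequence is
   the lower side of the squeeze. *)
have lim := seqB (seqM gap (seqV den0 den)) (@cvg_scale R).
rewrite subr0 in lim.
rewrite /increment -[X in X / _]real_normK ?num_real // expr2.
apply: (squeeze_cvgr _ lim); last exact: cvg_cst.
apply: nearW => j.
have pow0 : 0 < 2 ^+ j :> R by rewrite exprn_gt0.
have s1 : scale j * 2 ^+ j = 1 by rewrite mulVf // gt_eqF.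
have h := increment_approx_le nu_full mu_full nE mE s j.
have sj0 : 0 < scale j by rewrite invr_gt0.
apply/andP; split; last first.
  have := ler_wpM2l (ltW sj0) h; rewrite mulrA s1 mul1r.
  by rewrite /increment -[X in X / _]real_normK ?num_real // expr2.
(* Full support makes the upper brackets positive, so the integer division has a nonzero divisor. *)
have hi_gt0 (la : probability cantor_borel R) lo hi t : full_support la ->
    brackets la lo hi -> (0 < hi (t, j))%N.
  move=> la_full H; have [_ h2 _] := H t j.
  rewrite -(ltr_nat R); apply: lt_le_trans h2.
  by rewrite mulr_gt0 // weight_gt0.
have n0 t := hi_gt0 _ _ _ t nu_full nE; have m0 t := hi_gt0 _ _ _ t mu_full mE.
have dpos : (0 < den_approx s j)%N.
  by rewrite /den_approx !muln_gt0 !addn_gt0 !n0.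
have := ltn_ceil (2 ^ j * gap_approx s j ^ 2) dpos.
rewrite -/(increment_approx s j) -(ltr_nat R) (natrM _ (2 ^ j)).
rewrite (natrM _ _ (den_approx s j)) !natrX -[(increment_approx s j).+1%:R]natr1 => lt.
have dpos' : 0 < (den_approx s j)%:R :> R by rewrite ltr0n.
rewrite lerBlDr (_ : scale j * _ + scale j =
    scale j * ((increment_approx s j)%:R + 1)); last by ring.
have -> : scale j ^+ 2 * (gap_approx s j)%:R * (scale j ^+ 2 * (gap_approx s j)%:R) /
 (scale j * (nh (s, j))%:R *
  (scale j * (nh (s, j))%:R + scale j * (mh (s, j))%:R) *
  (scale j * (nh (rcons s false, j))%:R +
   scale j * (mh (rcons s false, j))%:R) *
  (scale j * (nh (rcons s true, j))%:R + scale j * (mh (rcons s true, j))%:R)) =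
  scale j * (2 ^+ j * (gap_approx s j)%:R ^+ 2 / (den_approx s j)%:R).
  have -> : scale j * (nh (s, j))%:R *
  (scale j * (nh (s, j))%:R + scale j * (mh (s, j))%:R) *
  (scale j * (nh (rcons s false, j))%:R +
   scale j * (mh (rcons s false, j))%:R) *
  (scale j * (nh (rcons s true, j))%:R + scale j * (mh (rcons s true, j))%:R) =
   scale j ^+ 4 * (den_approx s j)%:R.
    by rewrite /den_approx !natrM !natrD; ring.
  rewrite (_ : scale j = (2 ^+ j)^-1) //.
  by field; rewrite ?gt_eqF.
apply: ler_wpM2l; first exact: ltW.
by rewrite ler_pdivrMr //; exact: ltW.
Qed.

End increment_limit.

(** * The compensated martingale and the test for the sum *)

Section bounded_increments.
Variable R : realType.
Variables nu mu : probability cantor_borel R.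
Hypotheses (nu_full : full_support nu) (mu_full : full_support mu).

Definition increment_sum s : R := \sum_(i < size s) increment nu mu (take i s).

Lemma increment_sum_rcons s b : increment_sum (rcons s b) = increment_sum s + increment nu mu s.
Proof.
rewrite /increment_sum size_rcons big_ord_recr /=; congr (_ + _).
  by apply: eq_bigr => i _; rewrite -cats1 takel_cat // ltnW.
by rewrite -cats1 take_size_cat.
Qed.

Lemma increment_sum_ge0 s : 0 <= increment_sum s.
Proof. by apply: sumr_ge0 => i _; exact: increment_ge0. Qed.

Lemma increment_sum_mkseq (w : cantor_space) n :
  increment_sum (mkseq w n) = \sum_(i < n) increment nu mu (mkseq w i).
Proof.
rewrite /increment_sum size_mkseq; apply: eq_bigr => i _.
by rewrite /mkseq -map_take take_iota (minn_idPl _) // ltnW.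
Qed.

(* mu / (nu + mu) = 1 - nu / (nu + mu) plus the accumulated increments is a
   nu-martingale; multiplying by nu turns this into additivity. *)
Definition compensated s : R :=
  weight nu s * (weight mu s / (weight nu s + weight mu s) + increment_sum s).

Lemma compensated_ge0 s : 0 <= compensated s.
Proof.
by rewrite /compensated !(mulr_ge0, addr_ge0, invr_ge0, weight_ge0, increment_sum_ge0).
Qed.

(** Rests on a^2/x + b^2/y - (a + b)^2/(x + y) = (a y - b x)^2 / (x y (x + y)) with a = n0, b = n1,
    x = n0 + m0, y = n1 + m1, where a y - b x = n0 m1 - m0 n1. Divided by [weight nu s], the right
    side is [increment nu mu s]. *)
Lemma compensated_rcons s :
  compensated (rcons s false) + compensated (rcons s true) = compensated s.
Proof.
rewrite /compensated !increment_sum_rcons /increment !(weight_rcons _ s).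
have pos := weight_gt0 nu_full; have pos' := weight_gt0 mu_full.
have := pos (rcons s false); have := pos (rcons s true).
have := pos' (rcons s false); have := pos' (rcons s true).
set n0 := weight nu _; set n1 := weight nu _; set m0 := weight mu _; set m1 := weight mu _.
move=> m1_gt0 m0_gt0 n1_gt0 n0_gt0; field.
by rewrite !gt_eqF // ?addr_gt0 // ?addr_gt0.
Qed.

Lemma cvg_sum_scaled n (u : nat -> nat -> nat) (x : nat -> R) :
  (forall i, (fun j => @scale R j * (u i j)%:R) @ \oo --> x i) ->
  (fun j => @scale R j * (\sum_(i < n) u i j)%:R) @ \oo --> \sum_(i < n) x i.
Proof.
move=> ux; elim: n => [|n IH].
  under eq_cvg do rewrite big_ord0 mulr0.
  by rewrite big_ord0; exact: cvg_cst.
under eq_cvg do rewrite big_ord_recr /= natrD mulrDr.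
by rewrite big_ord_recr /=; apply: cvgD.
Qed.

(** Since the approximations are lower bounds, a firing is conclusive. No rate of convergence is
    computed: silence at all stages is used only through the limit of the approximations. *)
Lemma bounded_increment_sum w : computable_measure nu -> computable_measure mu ->
  MLR nu w -> exists C : R, forall n, \sum_(i < n) increment nu mu (mkseq w i) <= C.
Proof.
move=> /[dup] hnu /nat_bounds[nl [nh [hnl hnh nE]]].
move=> /nat_bounds[ml [mh [hml hmh mE]]] wR.
pose S s j := (\sum_(i < size s) increment_approx nl nh ml mh (take i s) j)%N.
pose T (p : nat * seq bool * nat) := (2 ^ p.1.1.+1 * 2 ^ p.2 < S p.1.2 p.2)%N.
have hT : computable_fun T.
  have c1 := @computable_fst (nat * seq bool)%type nat.
  have c2 := @computable_snd (nat * seq bool)%type nat.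
  have c12 := computable_comp (@computable_snd nat (seq bool)) c1.
  have c11 := computable_comp (@computable_fst nat (seq bool)) c1.
  apply: computable_leq.
    apply: computable_succ; apply: computable_muln; apply: computable_expn;
      [exact: computable_const|exact: (computable_succ c11)|exact: computable_const|exact: c2].
  apply: (computable_prefix_sum false (h := fun (p : nat * seq bool * nat) t =>
    increment_approx nl nh ml mh t p.2)) => //.
  apply: (computable_comp (computable_increment_approx hnl hnh hml hmh)
    (g := fun q : nat * seq bool * nat * seq bool => (q.1.2, q.2))).
  apply: computable_pair; last exact: computable_snd.
  exact: (computable_comp c2 (@computable_fst _ _)).
have T1 k s j : T (k, s, j) -> 2 ^+ k.+1 <= increment_sum s.
  rewrite /T /= => lt; have pow0 : 0 < 2 ^+ j :> R by rewrite exprn_gt0.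
  rewrite -(ler_pM2r pow0) -!natrX -natrM.
  apply: (@le_trans _ _ (S s j)%:R); first by rewrite ler_nat ltnW.
  rewrite natrX mulrC /S natr_sum mulr_sumr; apply: ler_sum => i _.
  exact: increment_approx_le.
have T2 k s : (forall j, ~~ T (k, s, j)) -> increment_sum s <= 2 ^+ k.+1.
  move=> nT; have lim := @cvg_sum_scaled (size s)
    (fun i j => increment_approx nl nh ml mh (take i s) j)
    (fun i => increment nu mu (take i s))
    (fun i => @cvg_increment_approx _ _ _ _ _ _ _ nu_full mu_full nE mE (take i s)).
  rewrite /increment_sum -(cvg_lim (@Rhausdorff R) lim); apply: limr_le.
    exact: cvgP lim.
  apply: nearW => j; have := nT j; rewrite /T /= -leqNgt -(ler_nat R) => le.
  rewrite mulrC ler_pdivrMr ?exprn_gt0 //.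
  by rewrite -!natrX -natrM.
have [k H] : exists k, forall n j, ~~ T (k, mkseq w n, j).
  apply: MLR_avoids hT _ wR => // k.
  set U := bigcup _ _.
  have mU : measurable (U : set cantor_borel) := measurable_bigcup_cylinder _.
  have := @ville R nu compensated [set s | exists j, T (k, s, j)] (2 ^+ k.+1).
  rewrite -/U -[nu U]fineK ?fin_num_measure // -EFinM !lee_fin => V.
  rewrite -(ler_pM2l (x := 2 ^+ k.+1)) ?exprn_gt0 // divff ?gt_eqF ?exprn_gt0 //.
  apply: le_trans (V _ _ _ _) _ => //.
  - exact: compensated_ge0.
  - by move=> s; rewrite compensated_rcons.
  - move=> s [j /T1 le]; rewrite mulrC /compensated ler_wpM2l ?weight_ge0 //.
    by rewrite (le_trans le) // lerDr divr_ge0 ?addr_ge0 ?weight_ge0.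
  (* At the empty string the martingale starts at 1/2, since both measures have total mass 1. *)
  - rewrite /compensated !weight_nil /increment_sum big_ord0 mul1r addr0 div1r.
    by rewrite invf_le1 // lerDl.
by exists (2 ^+ k.+1) => n; rewrite -increment_sum_mkseq; apply: T2 => j; exact: H.
Qed.

End bounded_increments.

Theorem theorem1p16 (R : realType) (nu : probability cantor_borel R)
  (nu_computable : computable_measure nu) (nu_full : full_support nu) :
  MLR nu `<=` MR2 nu.
Proof.
move=> w wR mu mu_computable mu_full numu.
have [C1 H1] := bounded_ratio_nu nu_computable mu_computable wR.
have [C2 H2] := bounded_ratio_mu nu_computable mu_computable numu wR.
have [D HD] := bounded_increment_sum nu_full mu_full nu_computable mu_computable wR.
(* One constant above both ratio bounds, with the successor ensuring [1 <= c]. *)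
pose c : R := (C1 + C2).+1%:R%R.
have c1 : (1 <= c)%R by rewrite ler1n.
have step n : (hellinger_step nu mu n w ^+ 2 <= 4 * c ^+ 3 * increment nu mu (mkseq w n))%R.
  apply: hellinger_step_le => //.
  - apply: le_trans (H2 n) _; rewrite ler_wpM2r ?weight_ge0 // ler_nat.
    by rewrite ltnW // ltnS leq_addl.
  - apply: le_trans (H1 n) _; rewrite ler_wpM2r ?weight_ge0 // ler_nat.
    by rewrite ltnW // ltnS leq_addr.
apply: (@le_lt_trans _ _ (4 * c ^+ 3 * D)%:E%R); last by rewrite ltry.
apply: lime_le.
  by apply: is_cvg_nneseries => n _ _; rewrite lee_fin sqr_ge0.
apply: nearW => n; rewrite sumEFin lee_fin big_mkord.
apply: (@le_trans _ _ (4 * c ^+ 3 * \sum_(i < n) increment nu mu (mkseq w i))%R).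
  by rewrite mulr_sumr; apply: ler_sum => i _; exact: step.
by apply: ler_wpM2l (HD n); rewrite mulr_ge0 ?exprn_ge0 // (le_trans _ c1).
Qed.
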